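(* Consider the closed-loop system $x_{k+1}=Ax_k+Bu_k+Dw_k$, $u_k=Kx_k+c^*_{0|k}(x_k)$, i.e. $x_{k+1}=(A+BK)x_k+Bc^*_{0|k}(x_k)+Dw_k$, under the receding horizon law described in the context, with bounded state space $\mathbf{X}$. For any $x_0\in\mathbf{X}$, the closed-loop system satisfies $$\lim_{k\rightarrow\infty}\mathbb{P}\Bigl\{x_k\in\bigoplus_{j=0}^\infty(A+BK)^jD\mathbf{W}\Bigr\}=1$$ and $$\lim_{k\rightarrow\infty}\frac1k\sum_{j=1}^k\bigl(x_j^\top Qx_j+u_j^\top Ru_j\bigr)=\lim_{k\rightarrow\infty}\mathbb{E}\bigl\{\xi_k^\top(Q+K^\top RK)\xi_k\bigr\}\quad\text{almost surely},$$ where $\xi_{k+1}=(A+BK)\xi_k+Dw_k$ for all $k\in\mathbb{N}$ and $\xi_0=x_0$.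
   Context: System: $x_{k+1}=Ax_k+Bu_k+Dw_k$, $x_k\in\mathbb{R}^{n_x}$, $u_k\in\mathbb{R}^{n_u}$, $w_k\in\mathbb{R}^{n_w}$, $(A,B)$ stabilizable, with $x_k$ measured at time $k$. The sequence $\{w_k\in\mathbf{W}:k\in\mathbb{N}\}$ is i.i.d. with $\mathbb{E}\{w_k\}=0$ and a non-singular (with respect to Lebesgue measure) distribution supported in $\mathbf{W}$, a bounded set containing the origin in its interior, and $\mathbb{P}\{\|w\|\le\lambda\}>0$ for all $\lambda>0$. The pair $(A+BK,D)$ is controllable. Constraints: one or several probabilistic constraints $\mathbb{P}\{f^\top x_{k+1}+g^\top u_k\le1\}\ge p$, with $f\in\mathbb{R}^{n_x}$, $g\in\mathbb{R}^{n_u}$, $p\in(0,1]$. Predicted inputs with horizon $N$ ($y_{i|k}$ is the prediction of $y_{k+i}$ made at time $k$): $u_{i|k}=Kx_{i|k}+c_{i|k}+\sum_{j=1}^{i}L_jw_{i-j|k}$ for $0\le i\le N-1$ and $u_{i|k}=Kx_{i|k}+\sum_{j=1}^{N-1}L_jw_{i-j|k}$ for $i\ge N$. The $c_{i|k}$ are the optimization variables, collected in the vector $\vec{c}_k=(c_{0|k},\dots,c_{N-1|k})$; the gains $L_1,\dots,L_{N-1}$ are fixed matrices computed offline. $Q,R\succ0$, and $K$ is the stabilizing gain satisfying $P=Q+A^\top PA-K^\top(R+B^\top PB)K$, $K=-(R+B^\top PB)^{-1}B^\top PA$. Optimal control problem at time $k$: minimize over $\vec{c}_k$ $$J=\mathbb{E}\Bigl\{\sum_{i=0}^\infty\bigl(x_{i|k}^\top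 Qx_{i|k}+u_{i|k}^\top Ru_{i|k}-L_{ss}\bigr)\Bigr\},\qquad L_{ss}=\lim_{i\to\infty}\mathbb{E}(x_{i|k}^\top Qx_{i|k}+u_{i|k}^\top Ru_{i|k}),$$ subject to $x_{0|k}=x_k$, $x_{i+1|k}=Ax_{i|k}+Bu_{i|k}+Dw_{i|k}$, the input parameterization $u_{i|k}=Kx_{i|k}+c_{i|k}+\sum_{j=1}^{i}L_jw_{i-j|k}$ for $0\le i\le N-1$ and $u_{i|k}=Kx_{i|k}+\sum_{j=1}^{N-1}L_jw_{i-j|k}$ for $i\ge N$, and $\mathbb{P}\{f^\top x_{i+1|k}+g^\top u_{i|k}\le1\}\ge p$ for all $0\le i\le N+N_2-1$, imposed for all disturbance realizations in $\mathbf{W}$ (i.e. for every realization of $w_{0|k},\dots,w_{i-1|k}\in\mathbf{W}$, the probability being over $w_{i|k}$; equivalently linear constraints on the nominal predictions tightened by parameters computed offline). $N_2$ is large enough that these constraints then hold for all $i\in\mathbb{N}$. The optimal solution is $\vec{c}_k^{\,*}=(c^*_{0|k},\dots,c^*_{N-1|k})$. $\mathbf{X}$ is the set of $x_k$ for which the problem is feasible; it is assumed bounded. The striped structure of the disturbance feedback ensures recursive feasibility: $x_{k+1}\in\mathbf{X}$ for every $x_k\in\mathbf{X}$ and $w_k\in\mathbf{W}$. The disturbance is small enough that the constraints are inactive, and $c^*_{0|k}(x)=0$, for $x$ in a neighbourhood of the origin; and if $c^*_{0|\bar k}(x_{\bar k})=0$ for some $\bar k$ then $c^*_{0|k}(x_k)=0$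 for all $k\ge\bar k$, so that $\mathbf{X}_f=\{x\in\mathbf{X}:c^*_{0|k}(x)=0\}$ is robustly invariant for the closed loop. $\bigoplus$ denotes Minkowski sum, so $\bigoplus_{j=0}^\infty(A+BK)^jD\mathbf{W}=\{\sum_{j=0}^\infty(A+BK)^jDw_j:w_j\in\mathbf{W}\}$. *)

(* Defs.v *)
From HB Require Import structures.
From mathcomp Require Import all_boot all_order all_algebra finmap.
From mathcomp Require Import all_classical all_reals all_analysis.

Set Implicit Arguments.
Unset Strict Implicit.
Unset Printing Implicit Defensive.

Import Order.TTheory GRing.Theory Num.Theory.
Import numFieldNormedType.Exports.

Local Open Scope classical_set_scope.
Local Open Scope ring_scope.

Definition qform (R : realType) (n : nat) (M : 'M[R]_n) (x : 'cV[R]_n) : R :=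
  (x^T *m M *m x) ord0 ord0.

Definition posdef (R : realType) (n : nat) (M : 'M[R]_n) : Prop :=
  M^T = M /\ forall x : 'cV[R]_n, x != 0 -> 0 < qform M x.

(* Asymptotic stability of the origin for x_{k+1} = M x_k. *)
Definition asymptotically_stable (R : realType) (n : nat) (M : 'M[R]_n) : Prop :=
  (forall e : R, 0 < e -> exists2 d : R, 0 < d &
     forall x : 'cV[R]_n, `|x| < d -> forall k : nat, `|(M ^+ k) *m x| < e) /\
  (forall x : 'cV[R]_n,
     (fun k : nat => (M ^+ k) *m x) @ \oo --> (0 : 'cV[R]_n)).

Definition stabilizing (R : realType) (nx nu : nat)
    (A : 'M[R]_nx) (B : 'M[R]_(nx, nu)) (K : 'M[R]_(nu, nx)) : Prop :=
  asymptotically_stable (A + B *m K).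

Definition stabilizable (R : realType) (nx nu : nat)
    (A : 'M[R]_nx) (B : 'M[R]_(nx, nu)) : Prop :=
  exists K : 'M[R]_(nu, nx), stabilizing A B K.

(* Full rank of the controllability matrix [B, A B, ..., A^(n-1) B]. *)
Definition controllable (R : realType) (n m : nat)
    (A : 'M[R]_n) (B : 'M[R]_(n, m)) : Prop :=
  \rank (\mxrow_(j < n) ((A ^+ j) *m B)) = n.

(* R^n carries no canonical measurable structure in the library. *)
Definition borel (R : realType) (n : nat) : set (set 'cV[R]_n) :=
  <<s (@open 'cV[R]_n) >>.
Arguments borel R n : clear implicits.

Definition random_vectors (d : measure_display) (Omega : measurableType d)
    (R : realType) (n : nat) (w : nat -> Omega -> 'cV[R]_n) : Prop :=
  forall k U, borel R n U -> measurable (w k @^-1` U).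

Definition mutually_independent (d : measure_display) (Omega : measurableType d)
    (R : realType) (P : probability Omega R) (n : nat)
    (w : nat -> Omega -> 'cV[R]_n) : Prop :=
  forall (J : {fset nat}) (U : nat -> set 'cV[R]_n),
    (forall k, borel R n (U k)) ->
    P (\bigcap_(k in [set` J]) (w k @^-1` U k)) =
    (\prod_(k <- J) P (w k @^-1` U k))%E.

Definition identically_distributed (d : measure_display)
    (Omega : measurableType d) (R : realType) (P : probability Omega R)
    (n : nat) (w : nat -> Omega -> 'cV[R]_n) : Prop :=
  forall k U, borel R n U -> P (w k @^-1` U) = P (w 0%N @^-1` U).

(* N has n-dimensional Lebesgue outer measure zero. *)
Definition lebesgue_null (R : realType) (n : nat) (N : set 'cV[R]_n) : Prop :=
  forall e : R, 0 < e -> exists a b : nat -> 'cV[R]_n,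
    [/\ forall k i, a k i ord0 <= b k i ord0,
        N `<=` \bigcup_k [set v | forall i, a k i ord0 <= v i ord0 <= b k i ord0]
      & (\sum_(0 <= k <oo) (\prod_(i < n) (b k i ord0 - a k i ord0))%R%:E
         <= e%:E)%E].

(* The law of X and Lebesgue measure are not mutually singular. *)
Definition nonsingular_law (d : measure_display) (Omega : measurableType d)
    (R : realType) (P : probability Omega R) (n : nat)
    (X : Omega -> 'cV[R]_n) : Prop :=
  ~ exists N : set 'cV[R]_n,
      [/\ borel R n N, lebesgue_null N & P (X @^-1` (~` N)) = 0%E].

(* For measurable E this is P E, see [inner_probE]; it gives a meaning to the
   probability of an event that is not known to be measurable. *)
Definition inner_prob (d : measure_display) (Omega : measurableType d)
    (R : realType) (P : probability Omega R) (E : set Omega) : \bar R :=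
  ereal_sup [set P F | F in [set F | measurable F /\ F `<=` E]].

Lemma inner_probE (d : measure_display) (Omega : measurableType d)
    (R : realType) (P : probability Omega R) (E : set Omega) :
  measurable E -> inner_prob P E = P E.
Proof.
move=> mE; apply/eqP; rewrite eq_le; apply/andP; split.
  apply: ge_ereal_sup => _ [F [mF FE] <-].
  by apply: le_measure; rewrite ?inE.
by apply: ereal_sup_ubound; exists E => //; split.
Qed.

Definition minkowski_series (R : realType) (nx nw : nat)
    (Phi : 'M[R]_nx) (D : 'M[R]_(nx, nw)) (W : set 'cV[R]_nw)
    : set 'cV[R]_nx :=
  [set s | exists2 v : nat -> 'cV[R]_nw, (forall j, W (v j)) &
     (fun n : nat => \sum_(j < n) (Phi ^+ j) *m (D *m v j)) @ \oo --> s].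

(* [c] has one entry per step of the horizon; only L 1, ..., L N.-1 are used. *)
Definition pred_input (R : realType) (nx nu nw N : nat)
    (K : 'M[R]_(nu, nx)) (L : nat -> 'M[R]_(nu, nw))
    (c : 'I_N -> 'cV[R]_nu) (v : nat -> 'cV[R]_nw)
    (i : nat) (xi : 'cV[R]_nx) : 'cV[R]_nu :=
  if insub i is Some ci
  then K *m xi + c ci + \sum_(1 <= j < i.+1) L j *m v (i - j)%N
  else K *m xi + \sum_(1 <= j < N) L j *m v (i - j)%N.

Fixpoint pred_state (R : realType) (nx nu nw N : nat)
    (A : 'M[R]_nx) (B : 'M[R]_(nx, nu)) (D : 'M[R]_(nx, nw))
    (K : 'M[R]_(nu, nx)) (L : nat -> 'M[R]_(nu, nw))
    (x : 'cV[R]_nx) (c : 'I_N -> 'cV[R]_nu) (v : nat -> 'cV[R]_nw)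
    (i : nat) : 'cV[R]_nx :=
  if i is i'.+1 then
    let xi := pred_state A B D K L x c v i' in
    A *m xi + B *m pred_input K L c v i' xi + D *m v i'
  else x.

(* The i-step-ahead constraint P{f^T x_{i+1|k} + g^T u_{i|k} <= 1} >= p, for all
   realizations v of w_{0|k}, ..., w_{i-1|k}, the probability being over
   w_{i|k} alone. *)
Definition constraint_at (d : measure_display) (Omega : measurableType d)
    (R : realType) (P : probability Omega R) (nx nu nw N : nat)
    (A : 'M[R]_nx) (B : 'M[R]_(nx, nu)) (D : 'M[R]_(nx, nw))
    (K : 'M[R]_(nu, nx)) (L : nat -> 'M[R]_(nu, nw))
    (W : set 'cV[R]_nw) (w : nat -> Omega -> 'cV[R]_nw)
    (f : 'cV[R]_nx) (g : 'cV[R]_nu) (p : R)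
    (x : 'cV[R]_nx) (c : 'I_N -> 'cV[R]_nu) (i : nat) : Prop :=
  forall v : nat -> 'cV[R]_nw, (forall j : nat, (j < i)%N -> W (v j)) ->
    let xi := pred_state A B D K L x c v i in
    let ui := pred_input K L c v i xi in
    (p%:E <= P [set omega |
       ((f^T *m (A *m xi + B *m ui + D *m w i omega) + g^T *m ui) ord0 ord0
         <= 1)%R])%E.

Definition feasible (d : measure_display) (Omega : measurableType d)
    (R : realType) (P : probability Omega R) (nx nu nw N m : nat)
    (A : 'M[R]_nx) (B : 'M[R]_(nx, nu)) (D : 'M[R]_(nx, nw))
    (K : 'M[R]_(nu, nx)) (L : nat -> 'M[R]_(nu, nw))
    (W : set 'cV[R]_nw) (w : nat -> Omega -> 'cV[R]_nw)
    (f : 'I_m -> 'cV[R]_nx) (g : 'I_m -> 'cV[R]_nu) (p : 'I_m -> R)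
    (N2 : nat) (x : 'cV[R]_nx) (c : 'I_N -> 'cV[R]_nu) : Prop :=
  forall (l : 'I_m) (i : nat), (i < N + N2)%N ->
    constraint_at P A B D K L W w (f l) (g l) (p l) x c i.

Definition feasible_set (d : measure_display) (Omega : measurableType d)
    (R : realType) (P : probability Omega R) (nx nu nw N m : nat)
    (A : 'M[R]_nx) (B : 'M[R]_(nx, nu)) (D : 'M[R]_(nx, nw))
    (K : 'M[R]_(nu, nx)) (L : nat -> 'M[R]_(nu, nw))
    (W : set 'cV[R]_nw) (w : nat -> Omega -> 'cV[R]_nw)
    (f : 'I_m -> 'cV[R]_nx) (g : 'I_m -> 'cV[R]_nu) (p : 'I_m -> R)
    (N2 : nat) : set 'cV[R]_nx :=
  [set x | exists c : 'I_N -> 'cV[R]_nu,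
     feasible P A B D K L W w f g p N2 x c].

Definition stage_cost (Omega : Type) (R : realType) (nx nu nw N : nat)
    (A : 'M[R]_nx) (B : 'M[R]_(nx, nu)) (D : 'M[R]_(nx, nw))
    (K : 'M[R]_(nu, nx)) (L : nat -> 'M[R]_(nu, nw))
    (Q : 'M[R]_nx) (Ru : 'M[R]_nu) (w : nat -> Omega -> 'cV[R]_nw)
    (x : 'cV[R]_nx) (c : 'I_N -> 'cV[R]_nu) (i : nat) (omega : Omega) : R :=
  let v := fun j : nat => w j omega in
  let xi := pred_state A B D K L x c v i in
  qform Q xi + qform Ru (pred_input K L c v i xi).

Definition steady_cost (d : measure_display) (Omega : measurableType d)
    (R : realType) (P : probability Omega R) (nx nu nw N : nat)
    (A : 'M[R]_nx) (B : 'M[R]_(nx, nu)) (D : 'M[R]_(nx, nw))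
    (K : 'M[R]_(nu, nx)) (L : nat -> 'M[R]_(nu, nw))
    (Q : 'M[R]_nx) (Ru : 'M[R]_nu) (w : nat -> Omega -> 'cV[R]_nw)
    (x : 'cV[R]_nx) (c : 'I_N -> 'cV[R]_nu) : R :=
  limn (fun i : nat => fine 'E_P[stage_cost A B D K L Q Ru w x c i]%E).

(* The random series in E{sum_{i >= 0} (l_i - L_ss)} does not converge pathwise;
   as usual its expectation is the limit of those of the partial sums.
   As {w_k} is i.i.d., w_0, w_1, ... serve as the predicted disturbances
   w_{0|k}, w_{1|k}, ... for every k. *)
Definition pred_cost (d : measure_display) (Omega : measurableType d)
    (R : realType) (P : probability Omega R) (nx nu nw N : nat)
    (A : 'M[R]_nx) (B : 'M[R]_(nx, nu)) (D : 'M[R]_(nx, nw))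
    (K : 'M[R]_(nu, nx)) (L : nat -> 'M[R]_(nu, nw))
    (Q : 'M[R]_nx) (Ru : 'M[R]_nu) (w : nat -> Omega -> 'cV[R]_nw)
    (x : 'cV[R]_nx) (c : 'I_N -> 'cV[R]_nu) : \bar R :=
  limn (fun n : nat => 'E_P[fun omega =>
    (\sum_(i < n) (stage_cost A B D K L Q Ru w x c i omega
                   - steady_cost P A B D K L Q Ru w x c))%R]%E).

Fixpoint trajectory (R : realType) (nx nw : nat)
    (F : 'cV[R]_nx -> 'cV[R]_nw -> 'cV[R]_nx)
    (x0 : 'cV[R]_nx) (v : nat -> 'cV[R]_nw) (k : nat) : 'cV[R]_nx :=
  if k is k'.+1 then F (trajectory F x0 v k') (v k') else x0.

(* Main.v *)
Require Import Defs.
From HB Require Import structures.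
From mathcomp Require Import all_boot all_order all_algebra finmap.
From mathcomp Require Import all_classical all_reals all_analysis measurable_realfun.
From mathcomp Require Import ring lra.

Set Implicit Arguments.
Unset Strict Implicit.
Unset Printing Implicit Defensive.

Import Order.TTheory GRing.Theory Num.Theory.
Import numFieldNormedType.Exports.

Local Open Scope classical_set_scope.
Local Open Scope ring_scope.

(** Completing the square with the Riccati equation turns the expected cost of a
    plan into [x'Sx] plus a positive definite quadratic form in the corrections plus
    a constant ([completing_square], [pred_cost_expansion]). The optimal corrections
    are therefore the feasible ones for which this form is least.

    Convergence. When the disturbance of the current step is known, the tail of
    the optimal plan, with the feedback of that disturbance added, is feasible at the
    next state ([constraint_at_shift]). Its correction cost is smaller by the cost of
    the correction just applied, up to a term of the order of the disturbance
    ([correction_cost_shift]). Together with the completed square this makes the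
    optimal cost a Lyapunov function [V] of the closed loop,
    [V(x+) <= V(x) - x'Qx + C |w|] ([optimal_cost_decrease]). The constant [C] and
    the boundedness of [V] rest on a bound for the optimal corrections over the
    feasible set ([optimal_corrections_bounded]): the problem is a quadratic programme
    with finitely many half-space constraints, and its solution depends linearly
    on the values of the active ones. It follows that a run of [r] sufficiently small
    disturbances brings every feasible state into any given ball around the origin
    ([lyapunov_entrance]). By controllability a small ball lies in the Minkowski
    series ([minkowski_series_ball]); near the origin the corrections vanish as well.
    The set where both hold is invariant, because the closed loop is linear on it and
    the series absorbs one more disturbance ([minkowski_series_step]). Since disjoint
    blocks of disturbances are independent, a run of [r] small ones has occurred by
    time [k] with probability tending to one ([no_run_cvg0]), and almost surely occurs
    at some time ([ae_run]). This proves the first claim.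

    Average cost. From that time on the corrections are zero, so the difference to the
    linear trajectory [xi] obeys the stable recursion without disturbance and vanishes;
    the costs then have the same averages ([average_transfer]). Along [xi] the Lyapunov
    equation writes the stage cost as a telescoping difference of [xi'S xi], plus the
    constant [E(w'D'SDw)], plus a bounded noise that is orthogonal to the past. The
    averages of that noise vanish almost surely by the strong law for bounded
    uncorrelated variables ([strong_law_uncorrelated]), while the expected stage costs
    converge to the same constant ([mean_stage_cvg]). *)

(** * Norms, quadratic forms and stable matrices *)

Section matrix_norm.
Context {R : realType}.

Lemma ler_mx_entry m n (M : 'M[R]_(m, n)) i j : `|M i j| <= `|M|.
Proof.
rewrite [leRHS]/Num.norm /= mx_normrE; apply/bigmax_geP; right => /=.
by exists (i, j).
Qed.

Lemma mx_norm_le m n (M : 'M[R]_(m, n)) (c : R) :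
  0 <= c -> (forall i j, `|M i j| <= c) -> `|M| <= c.
Proof.
move=> c0 Mc; rewrite [leLHS]/Num.norm /= mx_normrE.
by apply/bigmax_leP; split => // -[i j] _; exact: Mc.
Qed.

Lemma ler_norm_mulmx m n q (M : 'M[R]_(m, n)) (N : 'M[R]_(n, q)) :
  `|M *m N| <= n%:R * `|M| * `|N|.
Proof.
apply: mx_norm_le => [|i j]; first by rewrite !mulr_ge0.
rewrite mxE; apply: (le_trans (ler_norm_sum _ _ _)).
have -> : n%:R * `|M| * `|N| = \sum_(k < n) `|M| * `|N|.
  by rewrite sumr_const card_ord -mulrA mulr_natl.
by apply: ler_sum => k _; rewrite normrM ler_pM// ler_mx_entry.
Qed.

Lemma norm_trmx m n (M : 'M[R]_(m, n)) : `|M^T| = `|M|.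
Proof.
apply/eqP; rewrite eq_le; apply/andP; split; apply: mx_norm_le => // i j.
  by rewrite mxE ler_mx_entry.
by have := ler_mx_entry M^T j i; rewrite mxE.
Qed.

Lemma cvg_mulmx m n q (M : 'M[R]_(m, n)) (u : nat -> 'M[R]_(n, q)) s :
  u @ \oo --> s -> (fun k => M *m u k) @ \oo --> M *m s.
Proof.
move=> us; apply/cvgrPdist_lt => e e0.
have C0 : 0 < n%:R * `|M| + 1 :> R by rewrite ltr_wpDl// mulr_ge0.
have eC : 0 < e / (n%:R * `|M| + 1) by rewrite divr_gt0.
move/cvgrPdist_lt/(_ _ eC) : us; apply: filterS => k sk.
rewrite -mulmxBr (le_lt_trans (ler_norm_mulmx _ _))//.
rewrite (@le_lt_trans _ _ ((n%:R * `|M| + 1) * `|s - u k|))//.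
  by rewrite ler_wpM2r// lerDl.
by rewrite mulrC -ltr_pdivlMr.
Qed.

Lemma bounded_set_mx m n (A : set 'M[R]_(m, n)) :
  bounded_set A -> exists2 b : R, 0 <= b & forall x, A x -> `|x| <= b.
Proof.
case=> b [_ Ab]; exists (`|b| + 1); first by rewrite addr_ge0.
by move=> x; apply: Ab; rewrite (le_lt_trans (ler_norm b))// ltrDl.
Qed.

End matrix_norm.

Section forms.
Context {R : realType}.

Definition bform m n (M : 'M[R]_(m, n)) (x : 'cV[R]_m) (y : 'cV[R]_n) : R :=
  (x^T *m M *m y) ord0 ord0.

Lemma qformE n (M : 'M[R]_n) x : qform M x = bform M x x.
Proof. by []. Qed.

Lemma bformDl m n (M : 'M[R]_(m, n)) x x' y :
  bform M (x + x') y = bform M x y + bform M x' y.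
Proof. by rewrite /bform linearD/= !mulmxDl mxE. Qed.

Lemma bformDr m n (M : 'M[R]_(m, n)) x y y' :
  bform M x (y + y') = bform M x y + bform M x y'.
Proof. by rewrite /bform mulmxDr mxE. Qed.

Lemma bformZl m n (M : 'M[R]_(m, n)) a x y : bform M (a *: x) y = a * bform M x y.
Proof. by rewrite /bform linearZ/= -!scalemxAl mxE. Qed.

Lemma bformZr m n (M : 'M[R]_(m, n)) a x y : bform M x (a *: y) = a * bform M x y.
Proof. by rewrite /bform -!scalemxAr mxE. Qed.

Lemma bformNl m n (M : 'M[R]_(m, n)) x y : bform M (- x) y = - bform M x y.
Proof. by rewrite -scaleN1r bformZl mulN1r. Qed.

Lemma bformNr m n (M : 'M[R]_(m, n)) x y : bform M x (- y) = - bform M x y.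
Proof. by rewrite -scaleN1r bformZr mulN1r. Qed.

Lemma bform0r m n (M : 'M[R]_(m, n)) x : bform M x 0 = 0.
Proof. by rewrite -(scale0r 0) bformZr mul0r. Qed.

Lemma bform_tr m n (M : 'M[R]_(m, n)) x y : bform M x y = bform M^T y x.
Proof.
have E : (x^T *m M *m y)^T = y^T *m M^T *m x by rewrite !trmx_mul trmxK mulmxA.
by rewrite /bform -E [RHS]mxE.
Qed.

Lemma bformC n (M : 'M[R]_n) x y : M^T = M -> bform M x y = bform M y x.
Proof. by move=> sM; rewrite bform_tr sM. Qed.

Lemma bform_mulmx m n m' n' (M : 'M[R]_(m, n)) (F : 'M[R]_(m, m'))
    (G : 'M[R]_(n, n')) x y :
  bform M (F *m x) (G *m y) = bform (F^T *m M *m G) x y.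
Proof. by rewrite /bform trmx_mul !mulmxA. Qed.

Lemma bform_mxD m n (M N : 'M[R]_(m, n)) x y :
  bform (M + N) x y = bform M x y + bform N x y.
Proof. by rewrite /bform mulmxDr mulmxDl mxE. Qed.

Lemma bform_mxN m n (M : 'M[R]_(m, n)) x y : bform (- M) x y = - bform M x y.
Proof. by rewrite /bform mulmxN mulNmx mxE. Qed.

Lemma qform_mulmx m n (M : 'M[R]_m) (F : 'M[R]_(m, n)) x :
  qform M (F *m x) = qform (F^T *m M *m F) x.
Proof. exact: bform_mulmx. Qed.

Lemma qform_mxD n (M N : 'M[R]_n) x : qform (M + N) x = qform M x + qform N x.
Proof. exact: bform_mxD. Qed.

Lemma qformD n (M : 'M[R]_n) x y : M^T = M ->
  qform M (x + y) = qform M x + 2 * bform M x y + qform M y.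
Proof.
by move=> sM; rewrite qformE bformDl !bformDr (bformC y x sM) -!qformE; ring.
Qed.

Lemma qformZ n (M : 'M[R]_n) a x : qform M (a *: x) = a ^+ 2 * qform M x.
Proof. by rewrite !qformE bformZl bformZr mulrA expr2. Qed.

Lemma qform0 n (M : 'M[R]_n) : qform M 0 = 0.
Proof. exact: bform0r. Qed.

Lemma bform_bound m n (M : 'M[R]_(m, n)) :
  exists2 C : R, 0 <= C & forall x y, `|bform M x y| <= C * (`|x| * `|y|).
Proof.
exists (n%:R * (m%:R * `|M|)) => [|x y]; first by rewrite !mulr_ge0.
rewrite (le_trans (ler_mx_entry _ _ _))// (le_trans (ler_norm_mulmx _ _))//.
rewrite (mulrA _ `|x|) ler_wpM2r// -!mulrA ler_wpM2l//.
by rewrite (le_trans (ler_norm_mulmx _ _))// norm_trmx -!mulrA (mulrC `|x|).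
Qed.

Lemma qform_bound n (M : 'M[R]_n) :
  exists2 C : R, 0 <= C & forall x, `|qform M x| <= C * `|x| ^+ 2.
Proof.
by have [C C0 MC] := bform_bound M; exists C => // x; rewrite expr2; exact: MC.
Qed.

(** Cauchy-Schwarz, from the sign of the discriminant. *)
Lemma cauchy_schwarz n (M : 'M[R]_n) x y : M^T = M ->
  (forall z, 0 <= qform M z) -> bform M x y ^+ 2 <= qform M x * qform M y.
Proof.
move=> sM M0; set a := qform M x; set c := qform M y; set b := bform M x y.
have a0 : 0 <= a by exact: M0.
have c0 : 0 <= c by exact: M0.
have key s t : 0 <= s ^+ 2 * a + 2 * (s * t) * b + t ^+ 2 * c.
  have := M0 (s *: x + t *: y).
  by rewrite qformD// bformZl bformZr !qformZ -/a -/b -/c; nra.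
have [c00|cn0] := eqVneq c 0.
  have := key b (- (a + 1)); rewrite c00; nra.
have cp : 0 < c by rewrite lt_neqAle eq_sym cn0.
have := key c (- b).
have -> : c ^+ 2 * a + 2 * (c * - b) * b + (- b) ^+ 2 * c = c * (a * c - b ^+ 2).
  by ring.
by rewrite pmulr_rge0// subr_ge0.
Qed.

Lemma posdef_ge0 n (M : 'M[R]_n) x : posdef M -> 0 <= qform M x.
Proof.
move=> [_ M0]; have [->|/M0/ltW//] := eqVneq x 0; by rewrite qform0.
Qed.

Lemma posdef_eq0 n (M : 'M[R]_n) x : posdef M -> qform M x = 0 -> x = 0.
Proof.
move=> [_ M0] Mx; apply/eqP; apply/negPn/negP => /M0.
by rewrite Mx ltxx.
Qed.

Lemma posdef_unitmx n (M : 'M[R]_n) : posdef M -> M \in unitmx.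
Proof.
move=> pM; rewrite -row_free_unit -kermx_eq0; apply/eqP/row_matrixP => i.
rewrite row0; apply: trmx_inj; rewrite trmx0; apply: (posdef_eq0 pM).
have /sub_kermxP kM : (row i (kermx M) <= kermx M)%MS by exact: row_sub.
by rewrite /qform trmxK kM mul0mx mxE.
Qed.

(** Each coordinate [x_i] is the M-inner product of x with [M^-1 e_i], so
    Cauchy-Schwarz bounds the norm without appeal to compactness. *)
Lemma posdef_lower_bound n (M : 'M[R]_n) : posdef M ->
  exists2 q : R, 0 < q & forall x, q * `|x| ^+ 2 <= qform M x.
Proof.
move=> pM; have uM := posdef_unitmx pM; have [sM _] := pM.
pose z (i : 'I_n) : 'cV[R]_n := invmx M *m delta_mx i 0.
pose C := \sum_i qform M (z i).
have z0 i : 0 <= qform M (z i) by exact: posdef_ge0.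
have C0 : 0 <= C by exact: sumr_ge0.
exists (C + 1)^-1 => [|x]; first by rewrite invr_gt0 ltr_wpDl.
rewrite mulrC ler_pdivrMr ?ltr_wpDl//.
have qx := posdef_ge0 x pM.
rewrite -[leRHS]sqr_sqrtr ?mulr_ge0 ?addr_ge0//.
rewrite lerXn2r ?nnegrE ?sqrtr_ge0//.
apply: mx_norm_le => [|i j]; first exact: sqrtr_ge0.
rewrite -sqrtr_sqr ler_wsqrtr// (ord1 j).
have -> : x i 0 = bform M x (z i).
  by rewrite /bform /z -mulmxA (mulKVmx uM) -colE !mxE.
rewrite (le_trans (cauchy_schwarz _ _ sM _))//; first by move=> ?; exact: posdef_ge0.
rewrite ler_wpM2l// (@le_trans _ _ C) ?lerDl//.
by rewrite /C (bigD1 i)//= lerDl sumr_ge0.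
Qed.

End forms.

Section stability.
Context {R : realType}.

(** Young's inequality spends half of the decrease of the Lyapunov function on the
    cross term, and what remains gives [V(x+) <= (1 - a) V(x) + D]. *)
Lemma stable_bounded_response n (F S : 'M[R]_n) (q beta r : R) :
    S^T = S -> 0 < q -> 0 <= beta ->
    (forall x, q * `|x| ^+ 2 <= qform S x) ->
    (forall x, qform S (F *m x) <= qform S x - q * `|x| ^+ 2) ->
  exists C : R, forall x b : nat -> 'cV[R]_n,
    `|x 0%N| <= r -> (forall k, `|b k| <= beta) ->
    (forall k, x k.+1 = F *m x k + b k) -> forall k, `|x k| <= C.
Proof.
move=> sS q0 b0 Sge Sdec.
have [C C0 SC] := bform_bound S.
pose c := n%:R * `|F|.
have c0 : 0 <= c by rewrite mulr_ge0.
pose D := 2 * (C * c * beta) ^+ 2 / q + C * beta ^+ 2.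
have D0 : 0 <= D.
  by rewrite addr_ge0 ?mulr_ge0 ?exprn_ge0 ?invr_ge0 ?(ltW q0).
pose C' := C + q; have C'0 : 0 < C' by rewrite ltr_wpDl.
pose a := q / (2 * C').
have aC : a * (2 * C') = q by rewrite /a mulfVK// gt_eqF// mulr_gt0.
have a0 : 0 < a by rewrite divr_gt0// mulr_gt0.
have a1 : a <= 1.
  have qC : q <= C' by rewrite lerDr.
  by rewrite ler_pdivrMr ?mulr_gt0// mul1r; lra.
(* [D / a] is the fixed point of [s -> (1 - a) * s + D]. *)
pose M := C * r ^+ 2 + D / a.
exists (Num.sqrt (M / q)) => x b x0 bk xS.
suff SM k : qform S (x k) <= M.
  move=> k; rewrite -[leLHS]ger0_norm// -sqrtr_sqr ler_wsqrtr//.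
  by rewrite ler_pdivlMr// mulrC (le_trans (Sge _)).
have D0a : D = a * (D / a) by rewrite mulrC divfK// gt_eqF.
elim: k => [|k IH].
  rewrite (le_trans (ler_norm _))// (le_trans (SC _ _))// /M.
  rewrite -expr2 ler_wpDr ?(divr_ge0 D0 (ltW a0))// ler_wpM2l//.
  have r0 : 0 <= r := le_trans (normr_ge0 _) x0.
  by rewrite lerXn2r// nnegrE ?normr_ge0.
rewrite xS qformD//.
have := Sdec (x k); set t := `|x k|; set s := qform S (x k) in IH * => Sd.
have t0 : 0 <= t by exact: normr_ge0.
have Fx : `|F *m x k| <= c * t by exact: ler_norm_mulmx.
have cross : bform S (F *m x k) (b k) <= C * (c * t * beta).
  by rewrite (le_trans (ler_norm _))// (le_trans (SC _ _))// ler_wpM2l// ler_pM ?normr_ge0.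
have sb : qform S (b k) <= C * beta ^+ 2.
  rewrite (le_trans (ler_norm _))// (le_trans (SC _ _))// ler_wpM2l//.
  by rewrite -expr2 lerXn2r// nnegrE.
have st : s <= C' * t ^+ 2.
  rewrite (le_trans (ler_norm _))// (le_trans (SC _ _))// -expr2 ler_wpM2r//.
  by rewrite lerDl ltW.
have young : 2 * (C * (c * t * beta)) <= q / 2 * t ^+ 2 + 2 * (C * c * beta) ^+ 2 / q.
  have -> : 2 * (C * c * beta) ^+ 2 / q = q^-1 * (2 * (C * c * beta) ^+ 2) by ring.
  have qV : q * q^-1 = 1 by rewrite divff// gt_eqF.
  set e := C * c * beta; have -> : C * (c * t * beta) = e * t by rewrite /e; ring.
  have -> : q / 2 * t ^+ 2 + q^-1 * (2 * e ^+ 2)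
      = 2 * (e * t) + q^-1 / 2 * (q * t - 2 * e) ^+ 2.
    by field; rewrite gt_eqF.
  by rewrite lerDl mulr_ge0 ?sqr_ge0// divr_ge0// invr_ge0 ltW.
have as_ : a * s <= q / 2 * t ^+ 2.
  rewrite (le_trans (ler_wpM2l (ltW a0) st))// -aC.
  by rewrite le_eqVlt; apply/orP; left; apply/eqP; field.
have sD : qform S (F *m x k) + 2 * bform S (F *m x k) (b k) + qform S (b k)
    <= (1 - a) * s + D by rewrite /D; nra.
rewrite (le_trans sD)//.
have : (1 - a) * s <= (1 - a) * M by rewrite ler_wpM2l// subr_ge0.
suff : D <= a * M by nra.
by rewrite {1}D0a ler_wpM2l ?(ltW a0)// /M lerDr mulr_ge0// sqr_ge0.
Qed.

Lemma stable_cvg0 n (F : 'M[R]_n) (x : nat -> 'cV[R]_n) N :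
    asymptotically_stable F ->
    (forall k, (N <= k)%N -> x k.+1 = F *m x k) ->
  x @ \oo --> (0 : 'cV[R]_n).
Proof.
move=> [_ F0] xS.
have xE k : x (k + N)%N = (F ^+ k) *m x N.
  elim: k => [|k IH]; first by rewrite add0n expr0 mul1mx.
  by rewrite addSn xS ?leq_addl// IH exprS -mulmxA.
rewrite -(cvg_shiftn N); under eq_fun do rewrite xE.
exact: F0.
Qed.

Lemma cvg0_norm_bound m n (x : nat -> 'M[R]_(m, n)) : x @ \oo --> (0 : 'M[R]_(m, n)) ->
  forall e : R, 0 < e -> \forall k \near \oo, `|x k| < e.
Proof. by move=> /cvgr0Pnorm_lt x0 e /x0. Qed.

Lemma cvg_qform0 n (M : 'M[R]_n) (x : nat -> 'cV[R]_n) :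
  x @ \oo --> (0 : 'cV[R]_n) -> (fun k => qform M (x k)) @ \oo --> (0 : R).
Proof.
move=> x0; have [C C0 MC] := qform_bound M.
apply/cvgr0Pnorm_le => e e0.
have eC : 0 < Num.sqrt (e / (C + 1)) by rewrite sqrtr_gt0 divr_gt0// ltr_wpDl.
apply: filterS (cvg0_norm_bound x0 eC) => k xk.
rewrite (le_trans (MC _))// (@le_trans _ _ ((C + 1) * `|x k| ^+ 2))//.
  by rewrite ler_wpM2r ?sqr_ge0// lerDl.
rewrite mulrC -ler_pdivlMr ?ltr_wpDl//.
rewrite -[leRHS]sqr_sqrtr ?divr_ge0 ?addr_ge0 ?(ltW e0)//.
by rewrite lerXn2r ?nnegrE ?sqrtr_ge0// ltW.
Qed.

End stability.

Section minkowski.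
Context {R : realType} {nx nw : nat}.
Variables (F : 'M[R]_nx) (D : 'M[R]_(nx, nw)) (W : set 'cV[R]_nw).

(** The new disturbance becomes the first term and the given ones move one place up. *)
Lemma minkowski_series_step s v : minkowski_series F D W s -> W v ->
  minkowski_series F D W (F *m s + D *m v).
Proof.
move=> [u uW us] Wv; exists (fun j => if j is i.+1 then u i else v); first by case.
rewrite -(cvg_shiftn 1).
have E n : \sum_(j < n + 1) F ^+ j *m (D *m (if val j is i.+1 then u i else v)) =
    F *m (\sum_(j < n) F ^+ j *m (D *m u j)) + D *m v.
  rewrite addn1 big_ord_recl /= expr0 mul1mx addrC mulmx_sumr; congr (_ + _).
  by apply: eq_bigr => i _; rewrite /bump /= add1n exprS -mulmxA.
under eq_fun do rewrite E.
by apply: cvgD; [exact: cvg_mulmx|exact: cvg_cst].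
Qed.

(** The first [nx] terms already cover the whole space, and a linear choice of the
    disturbances is small when the target is. The other terms are zero. *)
Lemma minkowski_series_ball : controllable F D -> interior W 0 ->
  exists2 e : R, 0 < e & forall s, `|s| < e -> minkowski_series F D W s.
Proof.
move=> ctrl /nbhs_ballP[r /= r0 rW].
have /row_freeP[G FG] : row_free (\mxrow_(j < nx) (F ^+ j *m D)).
  by rewrite /row_free ctrl.
set C := `|G|.
pose c : R := (nx%:R * C + 1).
have c0 : 0 < c by rewrite ltr_wpDl// mulr_ge0 ?normr_ge0.
exists (r / c) => [|s sr]; first by rewrite divr_gt0.
pose v (j : nat) : 'cV[R]_nw :=
  if insub j is Some i then submxcol (G *m s) i else 0.
exists v => [j|].
  apply: rW; rewrite -ball_normE /= sub0r normrN /v.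
  case: insub => [i|]; last by rewrite normr0.
  rewrite (@le_lt_trans _ _ `|G *m s|)//.
    by apply: mx_norm_le => // k l; rewrite mxE ler_mx_entry.
  rewrite (le_lt_trans (ler_norm_mulmx _ _))//.
  rewrite (@le_lt_trans _ _ (c * `|s|))//; first by rewrite ler_wpM2r// lerDl.
  by rewrite mulrC -ltr_pdivlMr.
have sE : \sum_(j < nx) F ^+ j *m (D *m v j) = s.
  rewrite -[RHS]mul1mx -FG -mulmxA -[G *m s]submxcolK mul_mxrow_mxcol.
  apply: eq_bigr => i _; by rewrite /v valK -mulmxA.
apply: (@cvg_near_cst); exists nx => // n /= nxn.
rewrite -[RHS]sE -!(big_mkord xpredT (fun j => F ^+ j *m (D *m v j))).
rewrite (big_cat_nat (n := nx))//= [X in _ + X]big_nat.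
rewrite [X in _ + X]big1 ?addr0// => j /andP[nxj _].
by rewrite /v insubF ?mulmx0// ltnNge nxj.
Qed.

End minkowski.

(** * The linear-quadratic regulator and its predictions *)

Section lq_regulator.
Context {R : realType} {nx nu : nat}.
Variables (A : 'M[R]_nx) (B : 'M[R]_(nx, nu)).
Variables (Q S : 'M[R]_nx) (Ru : 'M[R]_nu) (K : 'M[R]_(nu, nx)).
Hypotheses (Q_posdef : posdef Q) (Ru_posdef : posdef Ru) (S_sym : S^T = S).
Let Psi := Ru + B^T *m S *m B.
Hypotheses (S_unit : Psi \in unitmx)
  (S_riccati : S = Q + A^T *m S *m A - K^T *m Psi *m K)
  (K_def : K = - (invmx Psi *m B^T *m S *m A)).
Hypothesis (K_stabilizing : stabilizing A B K).

Lemma input_weight_sym : Psi^T = Psi.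
Proof.
have [sR _] := Ru_posdef.
by rewrite linearD/= sR !trmx_mul trmxK S_sym mulmxA.
Qed.

(** The Riccati equation says that [u = K x] minimises the left-hand side, that [x'Sx]
    is the minimum and that [Psi] is the second-order coefficient. *)
Lemma completing_square x u :
  qform Q x + qform Ru u + qform S (A *m x + B *m u)
    = qform S x + qform Psi (u - K *m x).
Proof.
have PK : Psi *m K = - (B^T *m S *m A).
  by rewrite [in LHS]K_def mulmxN !mulmxA mulmxV// mul1mx.
have cross : bform S (A *m x) (B *m u) = - bform Psi u (K *m x).
  rewrite bformC// bform_mulmx.
  have -> : B^T *m S *m A = - (Psi *m K) by rewrite PK opprK.
  by rewrite bform_mxN /bform !mulmxA.
have qS : qform S x = qform Q x + qform S (A *m x) - qform Psi (K *m x).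
  rewrite {1}S_riccati 2!qform_mxD (qform_mulmx S A) (qform_mulmx Psi K).
  by rewrite !qformE bform_mxN.
have qu : qform Psi u = qform Ru u + qform S (B *m u).
  by rewrite qform_mxD qform_mulmx.
rewrite !qformD ?input_weight_sym// qS qu cross bformNr.
by rewrite [qform _ (- _)]qformE bformNl bformNr opprK -qformE; ring.
Qed.

Lemma lyapunov_equation x :
  qform S x = qform Q x + qform Ru (K *m x) + qform S ((A + B *m K) *m x).
Proof.
have := completing_square x (K *m x); rewrite subrr qform0 addr0 => <-.
by rewrite mulmxDl mulmxA.
Qed.

(** The value [x'Sx] of the unconstrained problem does not increase along the
    stable closed loop, on which it tends to zero; hence it is nonnegative. *)
Lemma riccati_ge0 x : 0 <= qform S x.
Proof.
pose F := A + B *m K; rewrite leNgt; apply/negP => Sx.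
have Sdec k : qform S ((F ^+ k) *m x) <= qform S x.
  elim: k => [|k IH]; first by rewrite expr0 mul1mx.
  rewrite (le_trans _ IH)// exprS -mulmxA [leRHS]lyapunov_equation -/F.
  by rewrite lerDr addr_ge0// posdef_ge0.
have [_ /(_ x) F0] := K_stabilizing.
have /cvgr0Pnorm_lt/(_ (- qform S x)) := cvg_qform0 S F0.
rewrite oppr_gt0 => /(_ Sx) [k _ /(_ k (leqnn k))] /=.
by rewrite ltNge lerNl (le_trans _ (Sdec k))// lerNl -normrN ler_norm.
Qed.

Lemma riccati_dominates x : qform Q x <= qform S x.
Proof.
rewrite [leRHS]lyapunov_equation -addrA lerDl addr_ge0//.
  exact: posdef_ge0.
exact: riccati_ge0.
Qed.

Lemma input_weight_posdef : posdef Psi.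
Proof.
split; first exact: input_weight_sym.
move=> u u0; have [_ /(_ _ u0) Ru0] := Ru_posdef.
by rewrite qform_mxD -qform_mulmx ltr_wpDr// riccati_ge0.
Qed.

Lemma lq_bounded_response (beta r : R) : 0 <= beta ->
  exists C : R, forall x b : nat -> 'cV[R]_nx,
    `|x 0%N| <= r -> (forall k, `|b k| <= beta) ->
    (forall k, x k.+1 = (A + B *m K) *m x k + b k) -> forall k, `|x k| <= C.
Proof.
move=> beta0; have [q q0 qQ] := posdef_lower_bound Q_posdef.
apply: (stable_bounded_response (S := S) _ S_sym q0) => // x.
  by rewrite (le_trans (qQ x))// riccati_dominates.
rewrite [in leRHS](lyapunov_equation x).
have := qQ x; have := posdef_ge0 (K *m x) Ru_posdef; lra.
Qed.

End lq_regulator.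

Section predictions.
Context {R : realType} {nx nu nw N : nat}.
Variables (A : 'M[R]_nx) (B : 'M[R]_(nx, nu)) (D : 'M[R]_(nx, nw)).
Variables (K : 'M[R]_(nu, nx)) (L : nat -> 'M[R]_(nu, nw)).
Hypothesis N_gt0 : (0 < N)%N.
Implicit Types (c : 'I_N -> 'cV[R]_nu) (v : nat -> 'cV[R]_nw).

(** Padding the corrections and the gains with zeros gives one formula for the inputs
    within and beyond the horizon. *)
Definition free_input c (i : nat) : 'cV[R]_nu :=
  if insub i is Some ci then c ci else 0.

Definition lag_gain (j : nat) : 'M[R]_(nu, nw) := if (j < N)%N then L j else 0.

Definition feedback_error c v (i : nat) : 'cV[R]_nu :=
  free_input c i + \sum_(j < i) lag_gain j.+1 *m v (i - j.+1)%N.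

Lemma free_inputE c (i : 'I_N) : free_input c i = c i.
Proof. by rewrite /free_input valK. Qed.

Lemma free_input0 c : free_input c 0 = c (Ordinal N_gt0).
Proof. exact: (free_inputE c (Ordinal N_gt0)). Qed.

Lemma free_input_ge c i : (N <= i)%N -> free_input c i = 0.
Proof. by move=> Ni; rewrite /free_input insubF// ltnNge Ni. Qed.

Lemma pred_inputE c v i xi :
  pred_input K L c v i xi = K *m xi + feedback_error c v i.
Proof.
have E : \sum_(j < i) lag_gain j.+1 *m v (i - j.+1)%N =
    \sum_(1 <= j < i.+1) lag_gain j *m v (i - j)%N.
  by rewrite big_add1/= big_mkord.
rewrite /pred_input /feedback_error /free_input E; case: insubP => [ci iN ci_i|iN].
  rewrite addrA; congr (_ + _); apply: eq_big_nat => j /andP[_ ji].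
  by rewrite /lag_gain (leq_ltn_trans _ iN)// -ltnS.
rewrite add0r; congr (_ + _); rewrite -leqNgt in iN.
rewrite [RHS](big_cat_nat (n := N))//=; last by rewrite (leq_trans iN).
rewrite [X in _ = _ + X]big_nat [X in _ = _ + X]big1 ?addr0.
  by apply: eq_big_nat => j /andP[_ jN]; rewrite /lag_gain jN.
by move=> j /andP[Nj _]; rewrite /lag_gain ltnNge Nj mul0mx.
Qed.

Lemma pred_stateS x c v i :
  pred_state A B D K L x c v i.+1 =
    (A + B *m K) *m pred_state A B D K L x c v i
    + B *m feedback_error c v i + D *m v i.
Proof. by rewrite /= pred_inputE mulmxDr mulmxA mulmxDl addrA. Qed.

Lemma feedback_error_lin a c c' v v' i :
  feedback_error (fun j => c j + a *: c' j) (fun j => v j + a *: v' j) i =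
  feedback_error c v i + a *: feedback_error c' v' i.
Proof.
rewrite /feedback_error scalerDr addrACA; congr (_ + _).
  by rewrite /free_input; case: insub => // ; rewrite scaler0 addr0.
rewrite scaler_sumr -big_split; apply: eq_bigr => j _ /=.
by rewrite mulmxDr scalemxAr.
Qed.

Lemma pred_state_lin a x x' c c' v v' i :
  pred_state A B D K L (x + a *: x') (fun j => c j + a *: c' j)
    (fun j => v j + a *: v' j) i =
  pred_state A B D K L x c v i + a *: pred_state A B D K L x' c' v' i.
Proof.
elim: i => // i IH; rewrite !pred_stateS IH feedback_error_lin.
move: (feedback_error c v i) (feedback_error c' v' i) => e e'.
rewrite !mulmxDr !scalerDr -!scalemxAr [RHS]addrACA; congr (_ + _).
by rewrite addrACA.
Qed.

Lemma feedback_error_split c v i :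
  feedback_error c v i =
  feedback_error c (fun=> 0) i + feedback_error ((fun=> 0) : 'I_N -> _) v i.
Proof.
rewrite -[feedback_error (fun=> 0) v i]scale1r -feedback_error_lin.
by congr feedback_error; apply/funext => j; rewrite scale1r ?addr0 ?add0r.
Qed.

Lemma pred_state_split x c v i :
  pred_state A B D K L x c v i =
  pred_state A B D K L x c (fun=> 0) i + pred_state A B D K L 0 ((fun=> 0) : 'I_N -> _) v i.
Proof.
rewrite -[pred_state _ _ _ _ _ _ (fun=> 0) v i]scale1r -pred_state_lin.
by congr pred_state; rewrite ?scaler0 ?addr0//; apply/funext => j;
  rewrite ?scaler0 ?addr0 ?add0r ?scale1r.
Qed.

(** A disturbance that has been observed no longer needs feedback: what the gains
    would make of it enters the corrections of the remaining plan. *)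
Definition shifted_input c (v0 : 'cV[R]_nw) : 'I_N -> 'cV[R]_nu :=
  fun j => free_input c j.+1 + lag_gain j.+1 *m v0.

Lemma feedback_error_shift c v i :
  feedback_error c v i.+1 =
  feedback_error (shifted_input c (v 0%N)) (fun j => v j.+1) i.
Proof.
rewrite /feedback_error big_ord_recr /= subnn addrCA addrC; congr (_ + _).
  rewrite [RHS]/free_input; case: insubP => [j jN ji|].
    by rewrite /shifted_input ji.
  rewrite -leqNgt => Ni; rewrite free_input_ge ?(leq_trans Ni)//.
  by rewrite /lag_gain ltnNge (leq_trans Ni)//= mul0mx addr0.
by apply: eq_bigr => j _; rewrite subSS -subSn.
Qed.

Lemma pred_state_shift x c v i :
  pred_state A B D K L x c v i.+1 =
  pred_state A B D K L
    (A *m x + B *m (K *m x + c (Ordinal N_gt0)) + D *m v 0%N)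
    (shifted_input c (v 0%N)) (fun j => v j.+1) i.
Proof.
elim: i => [|i IH]; last by rewrite pred_stateS IH feedback_error_shift -pred_stateS.
rewrite /= pred_inputE /feedback_error big_ord0 addr0.
by rewrite free_input0.
Qed.

Lemma pred_input_shift x c v i :
  pred_input K L c v i.+1 (pred_state A B D K L x c v i.+1) =
  pred_input K L (shifted_input c (v 0%N)) (fun j => v j.+1) i
    (pred_state A B D K L
      (A *m x + B *m (K *m x + c (Ordinal N_gt0)) + D *m v 0%N)
      (shifted_input c (v 0%N)) (fun j => v j.+1) i).
Proof. by rewrite pred_state_shift !pred_inputE feedback_error_shift. Qed.

(** The shifted plan loses the first correction and gains a zero at the end. *)
Lemma free_input_sum (V : zmodType) (h : 'cV[R]_nu -> V) c : h 0 = 0 ->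
  \sum_(i < N) h (free_input c i.+1) =
  \sum_(i < N) h (c i) - h (c (Ordinal N_gt0)).
Proof.
move=> h0; have -> : \sum_(i < N) h (c i) = \sum_(i < N) h (free_input c i).
  by apply: eq_bigr => i _; rewrite free_inputE.
have E : \sum_(i < N.+1) h (free_input c i) = \sum_(i < N) h (free_input c i).
  by rewrite big_ord_recr /= free_input_ge// h0 addr0.
rewrite -E big_ord_recl /= free_input0 addrC addKr.
by apply: eq_bigr.
Qed.

Definition correction_cost (Psi : 'M[R]_nu) c : R := \sum_(i < N) qform Psi (c i).

(** The observed disturbance enters a quadratic expression whose other argument is
    bounded by [r], so it contributes at most linearly. *)
Lemma correction_cost_shift (Psi : 'M[R]_nu) (r : R) : Psi^T = Psi ->
  exists2 C : R, 0 <= C & forall c (v : 'cV[R]_nw), (forall i, `|c i| <= r) -> `|v| <= 1 ->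
    correction_cost Psi (shifted_input c v) <=
    correction_cost Psi c - qform Psi (c (Ordinal N_gt0)) + C * `|v|.
Proof.
move=> sP; have [C C0 PC] := bform_bound Psi.
pose l' i : R := nw%:R * `|lag_gain i.+1|.
have l'0 i : 0 <= l' i by rewrite mulr_ge0.
pose E (i : 'I_N) := 2 * (C * (`|r| * l' i)) + C * (l' i) ^+ 2.
have E0 i : 0 <= E i by rewrite addr_ge0 ?mulr_ge0// ?sqr_ge0.
exists (\sum_i E i) => [|c v cr v1]; first exact: sumr_ge0.
rewrite -(free_input_sum (h := qform Psi)) ?qform0// mulr_suml -big_split/=.
apply: ler_sum => i _; rewrite /shifted_input qformD// -addrA lerD2l.
set a := free_input _ _; set b := _ *m v.
have ar : `|a| <= `|r|.
  rewrite /a /free_input; case: insub => [j|]; last by rewrite normr0.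
  by rewrite (le_trans (cr j))// ler_norm.
have bl : `|b| <= l' i * `|v| by exact: ler_norm_mulmx.
have bb : `|b| <= l' i by rewrite (le_trans bl)// ler_piMr.
rewrite /E [leRHS]mulrDl lerD//.
  rewrite -mulrA ler_pM2l// (le_trans (ler_norm _))// (le_trans (PC _ _))//.
  rewrite -(mulrA C) ler_wpM2l// -(mulrA _ (l' i)).
  by apply: ler_pM; rewrite ?normr_ge0.
rewrite (le_trans (ler_norm _))// (le_trans (PC _ _))// -mulrA ler_wpM2l//.
by rewrite expr2 -mulrA ler_pM ?normr_ge0.
Qed.

End predictions.

Section least_norm.
Context {R : realType}.

(** A vector orthogonal, for a definite form, to the kernel of [G] is determined
    linearly by its image under [G]. *)
Lemma orthogonal_kernel_bound n q (M : 'M[R]_n) (G : 'M[R]_(q, n)) : posdef M ->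
  exists2 C : R, 0 <= C & forall x : 'cV[R]_n,
    (forall h, G *m h = 0 -> bform M h x = 0) -> `|x| <= C * `|G *m x|.
Proof.
move=> pM; pose Z := kermx G^T.
(* [T] is injective: [T x = 0] puts [x] both in the kernel of [G] and orthogonal to it. *)
pose T := col_mx G (Z *m M).
have /row_freeP[H TH] : row_free T^T.
  rewrite -kermx_eq0; apply/eqP/row_matrixP => i; rewrite row0.
  set r := row i _.
  have /sub_kermxP rT : (r <= kermx T^T)%MS by exact: row_sub.
  have /eqP : T *m r^T = 0 by rewrite -[T]trmxK -trmx_mul rT trmx0.
  rewrite mul_col_mx col_mx_eq0 => /andP[/eqP Gr /eqP Zr].
  have /sub_kermxP : r *m G^T = 0 by rewrite -[LHS]trmxK trmx_mul trmxK Gr trmx0.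
  case/submxP => y; rewrite -/Z => ry; apply: trmx_inj; rewrite trmx0; apply: (posdef_eq0 pM).
  have rE : r *m M *m r^T = y *m (Z *m M *m r^T) by rewrite {1}ry -!mulmxA.
  by rewrite /qform trmxK rE Zr mulmx0 mxE.
exists ((q + n)%:R * `|H^T|) => [|x xG]; first by rewrite mulr_ge0.
have Zx : Z *m M *m x = 0.
  apply/matrixP => i j; rewrite (ord1 j) [RHS]mxE.
  have : bform M (row i Z)^T x = 0.
    apply: xG; apply: trmx_inj; rewrite trmx_mul trmxK trmx0.
    by apply/sub_kermxP; exact: row_sub.
  by rewrite /bform trmxK -!row_mul [in LHS]mxE.
have xE : x = H^T *m col_mx (G *m x) 0.
  by rewrite -[in RHS]Zx -mul_col_mx mulmxA -[col_mx _ _]trmxK -trmx_mul TH trmx1 mul1mx.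
rewrite {1}xE (le_trans (ler_norm_mulmx _ _))//.
rewrite ler_wpM2l ?mulr_ge0//; apply: mx_norm_le => // i j; rewrite mxE.
by case: splitP => k _; rewrite ?ler_mx_entry// mxE normr0.
Qed.

(** The first-order condition for a minimum along a line. *)
Lemma orthogonal_of_minimal n (M : 'M[R]_n) (x h : 'cV[R]_n) (e : R) : M^T = M ->
  0 < e -> (forall t, `|t| < e -> qform M x <= qform M (x + t *: h)) ->
  bform M h x = 0.
Proof.
move=> sM e0 min; rewrite bformC//.
set b := bform M x h; set a := qform M h.
have key t : `|t| < e -> 0 <= 2 * t * b + t ^+ 2 * a.
  move=> /min; rewrite qformD// bformZr qformZ -/a -/b; nra.
apply/eqP; apply/negPn/negP => b0.
(* A step [- s * b] so short that the quadratic term cannot offset the linear one. *)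
pose s := e / (2 * (`|b| + 1) * (`|a| + 1) * (e + 1)).
have e1 : 0 < e + 1 by rewrite addr_gt0.
have b1 : 0 < `|b| + 1 by rewrite ltr_wpDl.
have a1 : 0 < `|a| + 1 by rewrite ltr_wpDl.
have bb : 0 < `|b| by rewrite normr_gt0.
have s0 : 0 < s by rewrite divr_gt0// !mulr_gt0.
have sd : s * (2 * (`|b| + 1) * (`|a| + 1) * (e + 1)) = e.
  by rewrite divfK// gt_eqF// !mulr_gt0.
have sb : `|s * b| < e.
  rewrite normrM (gtr0_norm s0) -[ltRHS]sd ltr_pM2l//.
  have : 0 <= `|a| by []. have : 0 < (`|b| + 1) * e by rewrite mulr_gt0.
  have : 0 <= `|a| * ((`|b| + 1) * (e + 1)) by rewrite !mulr_ge0// ltW.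
  nra.
have sa : s * `|a| < 1.
  have : s * `|a| * e < e.
    rewrite -[ltRHS]sd -mulrA ltr_pM2l//.
    have : 0 <= `|a| by []. have : 0 < `|b| * (`|a| + 1) * (e + 1) by rewrite !mulr_gt0.
    have : 0 < (`|a| + 1) * e by rewrite mulr_gt0.
    nra.
  by move=> sae; rewrite -(ltr_pM2r e0) mul1r.
have := key (- (s * b)); rewrite normrN => /(_ sb).
have -> : 2 * - (s * b) * b + (- (s * b)) ^+ 2 * a = s * b ^+ 2 * (s * a - 2).
  by ring.
apply/negP; rewrite -ltNge pmulr_rlt0; last by rewrite mulr_gt0// exprn_even_gt0.
by have := ler_norm (s * a); rewrite normrM (gtr0_norm s0); lra.
Qed.

End least_norm.

(** * Bounded random variables and independence *)

Section indep.
Context d (Omega : measurableType d) (R : realType) (P : probability Omega R).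
Implicit Types (G H : set (set Omega)) (X Y : Omega -> R).

Definition sigma_measurable G X :=
  forall U : set R, measurable U -> <<s G >> (X @^-1` U).

Lemma sigma_measurableP G X :
  sigma_measurable G X <-> measurable_fun setT (X : g_sigma_algebraType G -> R).
Proof.
split=> [XG _ U mU|XG U mU]; first by rewrite setTI; exact: XG.
by rewrite -[X in <<s _ >> X]setTI; exact: XG.
Qed.

Lemma sub_sigma G H : G `<=` <<s H >> -> <<s G >> `<=` <<s H >>.
Proof. by apply: smallest_sub; exact: smallest_sigma_algebra. Qed.

Lemma sub_sigma_measurable G H X : <<s G >> `<=` <<s H >> ->
  sigma_measurable G X -> sigma_measurable H X.
Proof. by move=> GH XG U mU; apply: GH; exact: XG. Qed.

Lemma sigma_measurable_fun G X : G `<=` measurable ->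
  sigma_measurable G X -> measurable_fun setT X.
Proof.
move=> Gm XG _ U mU; rewrite setTI; move: (XG U mU).
by apply: smallest_sub => //; exact: sigma_algebra_measurable.
Qed.

(** Both sides are finite measures of the first argument; they agree on a pi-system,
    hence on the sigma-algebra it generates. *)
Lemma indep_generatedl G (B : set Omega) : setI_closed G -> G setT ->
    G `<=` measurable -> measurable B ->
    (forall A, G A -> P (A `&` B) = (P A * P B)%E) ->
  forall A, <<s G >> A -> P (A `&` B) = (P A * P B)%E.
Proof.
move=> GI GT Gm mB GB A sA.
have PB0 : 0 <= fine (P B) by rewrite fine_ge0.
have PBE : (fine (P B))%:E = P B by rewrite fineK// fin_num_measure.
have cover : \bigcup_(k : nat) (setT : set Omega) = setT.
  by rewrite bigcup_const//; exists 0%N.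
have := @g_sigma_algebra_measure_unique _ R Omega G Gm (fun=> setT) (fun=> GT)
  cover (mrestr P mB) (mscale (NngNum PB0) P) GI.
move=> H; have {}H : mrestr P mB A = mscale (NngNum PB0) P A.
  apply: H => // [C GC|_]; rewrite /mrestr/= /mscale/= ?PBE.
    exact: (etrans (GB _ GC) (muleC _ _)).
  apply: (@le_lt_trans _ _ 1%E); last exact: ltry.
  by apply: probability_le1; exact: measurableI.
by move: H; rewrite /mrestr/= /mscale/= PBE muleC.
Qed.

Lemma indep_generated G H : setI_closed G -> G setT -> G `<=` measurable ->
    setI_closed H -> H setT -> H `<=` measurable ->
    (forall A B, G A -> H B -> P (A `&` B) = (P A * P B)%E) ->
  forall A B, <<s G >> A -> <<s H >> B -> P (A `&` B) = (P A * P B)%E.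
Proof.
move=> GI GT Gm HI HT Hm GH A B sA sB.
have sGm : measurable A.
  by move: sA; apply: smallest_sub => //; exact: sigma_algebra_measurable.
rewrite setIC muleC; apply: (indep_generatedl HI HT Hm sGm _ sB) => {B sB} B HB.
rewrite setIC muleC; apply: (indep_generatedl GI GT Gm _ _ sA) => [|{sA sGm} A GA].
  exact: Hm.
exact: GH.
Qed.

(** The random variables whose expectations occur are polynomials in a bounded
    disturbance; this algebra contains them and consists of integrable functions. *)
Definition bounded_rv G X :=
  sigma_measurable G X /\ exists M : R, {ae P, forall omega, `|X omega| <= M}.

Lemma sub_bounded_rv G H X : <<s G >> `<=` <<s H >> ->
  bounded_rv G X -> bounded_rv H X.
Proof. by move=> GH [mX bX]; split => //; exact: sub_sigma_measurable mX. Qed.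

Lemma bounded_rv_cst G (a : R) : bounded_rv G (fun=> a).
Proof.
split; first by apply/sigma_measurableP; exact: measurable_cst.
by exists `|a|; apply: aeW => omega.
Qed.

Lemma bounded_rvD G X Y : bounded_rv G X -> bounded_rv G Y ->
  bounded_rv G (fun omega => X omega + Y omega).
Proof.
move=> [/sigma_measurableP mX [a Xa]] [/sigma_measurableP mY [b Yb]]; split.
  by apply/sigma_measurableP; exact: measurable_funD.
exists (a + b); move: Xa Yb; apply: filterS2 => omega Xa Yb.
by rewrite (le_trans (ler_normD _ _))// lerD.
Qed.

Lemma bounded_rvM G X Y : bounded_rv G X -> bounded_rv G Y ->
  bounded_rv G (fun omega => X omega * Y omega).
Proof.
move=> [/sigma_measurableP mX [a Xa]] [/sigma_measurableP mY [b Yb]]; split.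
  by apply/sigma_measurableP; exact: measurable_funM.
exists (a * b); move: Xa Yb; apply: filterS2 => omega Xa Yb.
by rewrite normrM ler_pM.
Qed.

Lemma bounded_rvZ G X a : bounded_rv G X -> bounded_rv G (fun omega => a * X omega).
Proof. by move=> bX; apply: bounded_rvM => //; exact: bounded_rv_cst. Qed.

Lemma bounded_rvB G X Y : bounded_rv G X -> bounded_rv G Y ->
  bounded_rv G (fun omega => X omega - Y omega).
Proof.
move=> bX bY; under eq_fun do rewrite -mulN1r.
by apply: bounded_rvD => //; exact: bounded_rvZ.
Qed.

Lemma bounded_rv_sum G (I : Type) (s : seq I) (p : pred I) (X : I -> Omega -> R) :
  (forall i, bounded_rv G (X i)) ->
  bounded_rv G (fun omega => \sum_(i <- s | p i) X i omega).
Proof.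
move=> bX; elim: s => [|i s IH].
  by under eq_fun do rewrite big_nil; exact: bounded_rv_cst.
under eq_fun do rewrite big_cons.
by case: (p i) => //; exact: bounded_rvD.
Qed.

Definition mean X : R := (\int[P]_omega X omega)%R.

Lemma eq_mean X Y : X =1 Y -> mean X = mean Y.
Proof. by move=> XY; congr mean; apply/funext. Qed.

Lemma bounded_rv_integrable G X : G `<=` measurable -> bounded_rv G X ->
  P.-integrable setT (EFin \o X).
Proof.
move=> Gm [mX [M XM]].
have mX' : measurable_fun setT (EFin \o X).
  by apply/measurable_EFinP; exact: sigma_measurable_fun mX.
apply/integrableP; split => //.
apply: (@le_lt_trans _ _ (`|M|%:E * P setT)%E).
  apply: integral_le_bound => //; apply: filterS XM => omega XM _ /=.
  by rewrite lee_fin (le_trans XM)// ler_norm.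
by rewrite probability_setT mule1 ltry.
Qed.

Section mean.
Variable G : set (set Omega).
Hypothesis Gm : G `<=` measurable.

Lemma expectation_mean X : bounded_rv G X -> ('E_P[X] = (mean X)%:E)%E.
Proof.
move=> bX; rewrite unlock /mean /Rintegral fineK//.
exact: integrable_fin_num (bounded_rv_integrable Gm bX).
Qed.

Lemma mean_cst (a : R) : mean (fun=> a) = a.
Proof.
have PT : fine (P setT) = 1 by rewrite probability_setT.
by rewrite /mean Rintegral_cst// -[RHS]mulr1 -[in RHS]PT.
Qed.

Lemma meanD X Y : bounded_rv G X -> bounded_rv G Y ->
  mean (fun omega => X omega + Y omega) = mean X + mean Y.
Proof.
by move=> bX bY; rewrite /mean RintegralD//; exact: (bounded_rv_integrable Gm).
Qed.

Lemma meanZ X a : bounded_rv G X -> mean (fun omega => a * X omega) = a * mean X.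
Proof. by move=> bX; rewrite /mean RintegralZl//; exact: (bounded_rv_integrable Gm). Qed.

Lemma meanB X Y : bounded_rv G X -> bounded_rv G Y ->
  mean (fun omega => X omega - Y omega) = mean X - mean Y.
Proof.
by move=> bX bY; rewrite /mean RintegralB//; exact: (bounded_rv_integrable Gm).
Qed.

Lemma mean_sum (I : Type) (s : seq I) (X : I -> Omega -> R) :
  (forall i, bounded_rv G (X i)) ->
  mean (fun omega => \sum_(i <- s) X i omega) = \sum_(i <- s) mean (X i).
Proof.
move=> bX; elim: s => [|i s IH].
  rewrite big_nil -[RHS](mean_cst 0).
  by apply: eq_mean => omega; rewrite big_nil.
rewrite big_cons -IH -meanD//; last exact: bounded_rv_sum.
by apply: eq_mean => ?; rewrite big_cons.
Qed.

Lemma mean_ge0 X : (forall omega, 0 <= X omega) -> 0 <= mean X.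
Proof. by move=> X0; exact: Rintegral_ge0. Qed.

Lemma mean_le_ae X (M : R) : 0 <= M -> bounded_rv G X ->
  {ae P, forall omega, `|X omega| <= M} -> mean X <= M.
Proof.
move=> M0 bX XM; have iX := bounded_rv_integrable Gm bX.
have mX := measurable_int _ iX.
rewrite -lee_fin -expectation_mean// unlock (le_trans (lee_abs _))//.
rewrite (le_trans (le_abse_integral P measurableT mX))//.
have -> : M%:E = (M%:E * P setT)%E by rewrite probability_setT mule1.
by apply: integral_le_bound; rewrite ?lee_fin//; apply: filterS XM => omega XM _.
Qed.

End mean.

(** The joint law of X and Y is the product of their laws, so Fubini applies. *)
Lemma mean_indep G H X Y : G `<=` measurable -> H `<=` measurable ->
    bounded_rv G X -> bounded_rv H Y ->
    (forall A B, <<s G >> A -> <<s H >> B -> P (A `&` B) = (P A * P B)%E) ->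
  mean (fun omega => X omega * Y omega) = mean X * mean Y.
Proof.
move=> Gm Hm bX bY ind.
have iX := bounded_rv_integrable Gm bX; have iY := bounded_rv_integrable Hm bY.
have [sX [a Xa]] := bX; have [sY [b Yb]] := bY.
have mX := sigma_measurable_fun Gm sX; have mY := sigma_measurable_fun Hm sY.
have iXY : P.-integrable setT (EFin \o (fun omega => X omega * Y omega)).
  have sub U Z : U `<=` measurable -> bounded_rv U Z -> bounded_rv measurable Z.
    move=> Um; apply: sub_bounded_rv; apply: sub_sigma => A UA.
    by apply: sub_sigma_algebra; exact: Um.
  apply: (bounded_rv_integrable (G := measurable)) => //.
  by apply: bounded_rvM; [exact: (sub _ _ Gm)|exact: (sub _ _ Hm)].
pose mmX := isMeasurableFun.Build _ _ _ _ X mX.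
pose X' : {mfun Omega >-> R} := HB.pack X mmX.
pose mmY := isMeasurableFun.Build _ _ _ _ Y mY.
pose Y' : {mfun Omega >-> R} := HB.pack Y mmY.
pose mXY := measurable_fun_pair mX mY.
pose mmXY := isMeasurableFun.Build _ _ _ _ _ mXY.
pose XY : {mfun Omega >-> (R * R)%type} := HB.pack (fun w => (X w, Y w)) mmXY.
pose m1 := distribution P X'; pose m2 := distribution P Y'.
pose m := distribution P XY.
have mE : forall U, measurable U -> (m1 \x m2)%E U = m U.
  apply: product_measure_unique => U V mU mV.
  rewrite /m /m1 /m2 /distribution /pushforward /=.
  by apply: ind; [exact: sX|exact: sY].
pose h (z : R * R) := (z.1 * z.2)%:E.
have mh : measurable_fun setT h.
  by apply/measurable_EFinP; apply: measurable_funM.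
have ih : (m1 \x m2)%E.-integrable setT h.
  apply/integrableP; split => //.
  rewrite (eq_measure_integral m); last by move=> U mU _; exact: mE.
  rewrite ge0_integral_distribution//; last exact: measurableT_comp.
  by have /integrableP[] := iXY.
have E : (\int[P]_omega (X omega * Y omega)%:E = (mean X * mean Y)%:E)%E.
  transitivity (\int[m]_z h z)%E.
    by rewrite integral_distribution.
  transitivity (\int[(m1 \x m2)%E]_z h z)%E.
    by apply: eq_measure_integral => U mU _; exact/esym/mE.
  rewrite -integral12_prod_meas1// /fubini_F /h /=.
  have EY x : (\int[m2]_y (x * y)%:E = (x * mean Y)%:E)%E.
    rewrite integral_distribution//=; last 2 first.
    - by apply/measurable_EFinP; exact: measurable_funM.
    - by have := integrableZl measurableT x iY.
    have := integralZl measurableT iY x.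
    by rewrite EFinM -(expectation_mean Hm bY) unlock.
  under eq_integral do rewrite EY.
  rewrite integral_distribution//=; last 2 first.
  - by apply/measurable_EFinP; exact: measurable_funM.
  - by have := integrableZr measurableT (mean Y) iX.
  have := integralZr measurableT iX (mean Y).
  by rewrite EFinM -(expectation_mean Gm bX) unlock.
by rewrite {1}/mean /Rintegral E.
Qed.

Lemma mean_eq_law G H X Y : G `<=` measurable -> H `<=` measurable ->
    bounded_rv G X -> bounded_rv H Y ->
    (forall U, measurable U -> P (X @^-1` U) = P (Y @^-1` U)) ->
  mean X = mean Y.
Proof.
move=> Gm Hm bX bY XY.
have iX := bounded_rv_integrable Gm bX; have iY := bounded_rv_integrable Hm bY.
have mX := sigma_measurable_fun Gm bX.1; have mY := sigma_measurable_fun Hm bY.1.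
pose mmX := isMeasurableFun.Build _ _ _ _ X mX.
pose X' : {mfun Omega >-> R} := HB.pack X mmX.
pose mmY := isMeasurableFun.Build _ _ _ _ Y mY.
pose Y' : {mfun Omega >-> R} := HB.pack Y mmY.
apply: EFin_inj; rewrite -(expectation_mean Gm bX) -(expectation_mean Hm bY) unlock.
transitivity (\int[distribution P X']_x x%:E)%E.
  by rewrite integral_distribution.
rewrite (eq_measure_integral (distribution P Y')); last by move=> U mU _; exact: XY.
by rewrite integral_distribution.
Qed.

End indep.

Section borel.
Context {R : realType}.

Lemma borel_continuous n (phi : 'cV[R]_n -> R) : continuous phi ->
  forall U, measurable U -> borel R n (phi @^-1` U).
Proof.
move=> /continuousP cphi.
suff : measurable_fun setT (phi : g_sigma_algebraType (@open 'cV[R]_n) -> R).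
  by move=> mphi U mU; rewrite -[X in borel _ _ X]setTI; exact: mphi.
apply: (measurability _ (RGenOpens.measurableE R)).
move=> _ [_ [a [b ->] <-]]; rewrite setTI; apply: sub_sigma_algebra.
exact/cphi/interval_open.
Qed.

Lemma coord_borel n (i : 'I_n) :
  measurable_fun setT
    ((fun y => y i ord0) : g_sigma_algebraType (@open 'cV[R]_n) -> R).
Proof.
move=> _ V mV; rewrite setTI.
by apply: (borel_continuous (phi := fun y : 'cV[R]_n => y i ord0)) => //;
  exact: coord_continuous.
Qed.

Lemma borel_closed n (F : set 'cV[R]_n) : closed F -> borel R n F.
Proof.
move=> cF; rewrite -[F]setCK; apply: sigma_algebraC.
by apply: sub_sigma_algebra; exact: closed_openC.
Qed.

Lemma borelT n : borel R n setT.
Proof. by apply: sub_sigma_algebra; exact: openT. Qed.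

Lemma borelI n (U V : set 'cV[R]_n) : borel R n U -> borel R n V ->
  borel R n (U `&` V).
Proof. exact: (@measurableI _ (g_sigma_algebraType (@open 'cV[R]_n))). Qed.

End borel.

Section disturbance.
Context d (Omega : measurableType d) (R : realType) (P : probability Omega R).
Context (n : nat) (w : nat -> Omega -> 'cV[R]_n).
Hypotheses (w_random : random_vectors w) (w_indep : mutually_independent P w).

(** The cylinder events of the first [j] disturbances and the events of a single one
    form pi-systems on which independence holds by hypothesis; it is extended to the
    sigma-algebras they generate. *)
Definition past (j : nat) : set (set Omega) :=
  [set A | exists2 U : nat -> set 'cV[R]_n, (forall k, borel R n (U k)) &
     A = \bigcap_(k in `I_j) (w k @^-1` U k)].

Definition present (j : nat) : set (set Omega) :=
  [set A | exists2 U, borel R n U & A = w j @^-1` U].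

Lemma past_setI j : setI_closed (past j).
Proof.
move=> _ _ [U bU ->] [V bV ->]; exists (fun k => U k `&` V k) => [k|].
  exact: borelI.
by rewrite -bigcapI.
Qed.

Lemma past_setT j : past j setT.
Proof.
exists (fun=> setT) => [k|]; first exact: borelT.
by apply/seteqP; split=> omega // _ k _.
Qed.

Lemma past_measurable j : past j `<=` measurable.
Proof.
move=> _ [U bU ->]; case: j => [|j].
  by rewrite bigcap_mkord big_ord0; exact: measurableT.
by apply: bigcap_measurable => [|k _]; [exists 0%N|exact: w_random].
Qed.

Lemma present_setI j : setI_closed (present j).
Proof.
move=> _ _ [U bU ->] [V bV ->]; exists (U `&` V) => //; exact: borelI.
Qed.

Lemma present_setT j : present j setT.
Proof. by exists setT => //; exact: borelT. Qed.

Lemma present_measurable j : present j `<=` measurable.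
Proof. by move=> _ [U bU ->]; exact: w_random. Qed.

Lemma past_le i j : (i <= j)%N -> <<s past i >> `<=` <<s past j >>.
Proof.
move=> ij; apply: sub_sigma => _ [U bU ->]; apply: sub_sigma_algebra.
exists (fun k => if (k < i)%N then U k else setT) => [k|].
  by case: ifP => // _; exact: borelT.
apply/seteqP; split=> omega /= Uo k /= kj.
  by case: ifP => // ki; exact: Uo.
by have := Uo k; rewrite /= kj (leq_trans kj ij); exact.
Qed.

Lemma present_past i j : (i < j)%N -> <<s present i >> `<=` <<s past j >>.
Proof.
move=> ij; apply: sub_sigma => _ [U bU ->]; apply: sub_sigma_algebra.
exists (fun k => if k == i then U else setT) => [k|].
  by case: ifP => // _; exact: borelT.
apply/seteqP; split=> omega /= Uo.
  by move=> k _ /=; case: eqP => [->|].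
by have := Uo i ij; rewrite /= eqxx.
Qed.

Lemma past_prob j (U : nat -> set 'cV[R]_n) : (forall k, borel R n (U k)) ->
  P (\bigcap_(k in `I_j) (w k @^-1` U k)) = (\prod_(k < j) P (w k @^-1` U k))%E.
Proof.
move=> bU; have := w_indep [fset k in iota 0 j]%fset bU.
have -> : [set` [fset k in iota 0 j]%fset] = `I_j.
  by apply/seteqP; split => k; rewrite /= !inE mem_iota add0n.
move=> ->; rewrite -(big_mkord xpredT (fun k => P (w k @^-1` U k))).
rewrite /index_iota subn0; apply: perm_big; apply: uniq_perm.
- exact: fset_uniq.
- exact: iota_uniq.
- by move=> k; rewrite !inE.
Qed.

Lemma past_present_indep j A B : <<s past j >> A -> <<s present j >> B ->
  P (A `&` B) = (P A * P B)%E.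
Proof.
apply: indep_generated; [exact: past_setI|exact: past_setT|exact: past_measurable|
  exact: present_setI|exact: present_setT|exact: present_measurable|].
move=> _ _ [U bU ->] [V bV ->].
pose U' k := if k == j then V else U k.
have bU' k : borel R n (U' k) by rewrite /U'; case: ifP.
have -> : \bigcap_(k in `I_j) (w k @^-1` U k) `&` w j @^-1` V =
    \bigcap_(k in `I_j.+1) (w k @^-1` U' k).
  apply/seteqP; split=> omega.
    move=> [Uo Vo] k /=; rewrite ltnS leq_eqVlt /U' => /orP[/eqP ->|kj].
      by rewrite eqxx.
    by rewrite ltn_eqF//; exact: Uo.
  move=> U'o; split=> [k kj|].
    by have := U'o k (ltnW kj); rewrite /U' /= ltn_eqF.
  by have := U'o j (leqnn _); rewrite /U' /= eqxx.
rewrite !past_prob// big_ord_recr /= {2}/U' eqxx; congr (_ * _)%E.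
by apply: eq_bigr => k _; rewrite /U' ltn_eqF.
Qed.

End disturbance.

(** * A strong law for bounded uncorrelated sequences *)

Section averages.
Context {R : realType}.

Lemma integer_sqrt k : exists m : nat, (m ^ 2 <= k < m.+1 ^ 2)%N.
Proof.
elim: k => [|k [m /andP[mk km]]]; first by exists 0%N.
have [k1|k1] := ltnP k.+1 (m.+1 ^ 2).
  by exists m; rewrite k1 (leq_trans mk).
by exists m.+1; rewrite k1 (leq_ltn_trans km)// ltn_sqr ltnS leqnn.
Qed.

(** Along the squares consecutive indices [m^2] and [(m+1)^2] differ by only
    [2m+1], so bounded increments carry convergence of the averages to all indices. *)
Lemma average_from_squares (s : nat -> R) (C : R) : 0 <= C ->
    (forall k, `|s k.+1 - s k| <= C) ->
    (fun m => s (m.+1 ^ 2)%N / (m.+1 ^ 2)%:R) @ \oo --> (0 : R) ->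
  (fun k => k%:R^-1 * s k) @ \oo --> (0 : R).
Proof.
move=> C0 ds sq.
have gap k j : `|s (k + j)%N - s k| <= C * j%:R.
  elim: j => [|j IH]; first by rewrite addn0 subrr normr0 mulr0.
  rewrite addnS (_ : _ - _ = (s (k + j).+1 - s (k + j)%N) + (s (k + j)%N - s k)).
    by rewrite (le_trans (ler_normD _ _))// mulrS mulrDr mulr1 lerD.
  by ring.
apply/cvgr0Pnorm_lt => e e0.
have e2 : 0 < e / 2 by rewrite divr_gt0.
have /cvgr0Pnorm_lt/(_ _ e2)[M _ sM] := sq.
have [M' M'e] : exists M' : nat, 4 * C / e < M'%:R.
  by exists (Num.bound (4 * C / e)); rewrite archi_boundP// divr_ge0 ?mulr_ge0// ltW.
exists ((maxn M M').+2 ^ 2)%N => // k /= Mk.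
have [m /andP[mk km]] := integer_sqrt k.
have Mm : (maxn M M' < m.-1)%N.
  have : (maxn M M' + 2 < m.+1)%N.
    by rewrite -(ltn_sqr) (leq_ltn_trans _ km)// addn2.
  by case: m {mk km} => [|m] //=; rewrite addn2 !ltnS.
have m0 : (0 < m)%N by case: m Mm {mk km}.
have mE : m = m.-1.+1 by rewrite prednK.
have mR : 0 < m%:R :> R by rewrite ltr0n.
have m2R : 0 < (m ^ 2)%:R :> R by rewrite ltr0n expn_gt0 m0.
have kR : 0 < k%:R :> R by rewrite ltr0n (leq_trans _ mk)// expn_gt0 m0.
have := sM m.-1; rewrite /= -mE => /(_ (leq_trans (leq_maxl _ _) (ltnW Mm))).
rewrite normrM (gtr0_norm (x := (m ^ 2)%:R^-1)) ?invr_gt0// ltr_pdivrMr// => sm.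
rewrite normrM (gtr0_norm (x := k%:R^-1)) ?invr_gt0// mulrC ltr_pdivrMr//.
have := gap (m ^ 2)%N (k - m ^ 2)%N; rewrite subnKC// => gk.
have j2m : ((k - m ^ 2)%N%:R : R) <= 2 * m%:R.
  rewrite -natrM ler_nat leq_subLR -ltnS (leq_trans km)//.
  by rewrite -[m.+1]addn1 sqrnD exp1n muln1 addn1 addSn.
have Cm : 2 * (C * (2 * m%:R)) <= e * (m ^ 2)%:R.
  have : 4 * C / e <= m%:R.
    rewrite (le_trans (ltW M'e))// ler_nat (leq_trans (leq_maxr M M'))//.
    by rewrite (leq_trans (ltnW Mm))// leq_pred.
  rewrite ler_pdivrMr// => CE; rewrite natrX expr2; nra.
have mkR : (m ^ 2)%:R <= k%:R :> R by rewrite ler_nat.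
have : `|s k| <= `|s (m ^ 2)%N| + `|s k - s (m ^ 2)%N|.
  by rewrite (le_trans _ (ler_normD _ _))// addrC subrK.
have : C * (k - m ^ 2)%N%:R <= C * (2 * m%:R) by rewrite ler_wpM2l.
nra.
Qed.

(** [1/a^2 <= 2 (1/a - 1/(a+1))] for [a >= 1], and the right-hand side telescopes. *)
Lemma sum_inv_sqr n : \sum_(0 <= m < n) (m.+1%:R ^+ 2)^-1 <= 3 :> R.
Proof.
suff H : \sum_(0 <= m < n) (m.+1%:R ^+ 2)^-1 <= 3 - 2 * n.+1%:R^-1 :> R.
  by rewrite (le_trans H)// gerBl mulr_ge0// invr_ge0.
elim: n => [|n IH]; first by rewrite big_geq// invr1; lra.
rewrite big_nat_recr//= (le_trans (lerD IH (lexx _)))//.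
rewrite -[n.+2%:R]natr1; have a1 : 1 <= n.+1%:R :> R by rewrite ler1n.
set a := n.+1%:R in a1 *; have a0 : 0 < a by rewrite (lt_le_trans ltr01).
rewrite -subr_ge0.
have -> : 3 - 2 * (a + 1)^-1 - (3 - 2 * a^-1 + (a ^+ 2)^-1) =
    (a - 1) / (a ^+ 2 * (a + 1)).
  by field; rewrite !gt_eqF// addr_gt0.
by rewrite divr_ge0 ?subr_ge0// mulr_ge0 ?sqr_ge0// addr_ge0// ltW.
Qed.

End averages.

Section strong_law.
Context d (Omega : measurableType d) (R : realType) (P : probability Omega R).
Local Notation mean := (mean P).

(** By monotone convergence the sum of the series is integrable, hence finite almost
    surely, and then its terms tend to zero. *)
Lemma ae_cvg0_of_summable_means (T : nat -> Omega -> R) (M : R) :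
    (forall m omega, 0 <= T m omega) ->
    (forall m, bounded_rv P measurable (T m)) ->
    (forall n, \sum_(0 <= m < n) mean (T m) <= M) ->
  {ae P, forall omega, (fun m => T m omega) @ \oo --> (0 : R)}.
Proof.
move=> T0 bT TM.
have mT m : measurable_fun setT (fun omega => (T m omega)%:E).
  apply/measurable_EFinP; apply: (sigma_measurable_fun (G := measurable)) => //.
  exact: (bT m).1.
have T0' m omega : (0 <= (T m omega)%:E)%E by rewrite lee_fin.
pose Z omega := (\sum_(0 <= m <oo) (T m omega)%:E)%E.
have Zfin : (\int[P]_omega Z omega <= M%:E)%E.
  rewrite integral_nneseries//.
  apply: lime_le; first by apply: is_cvg_nneseries => m _ _; exact: integral_ge0.
  apply: nearW => n.
  have E m : (\int[P]_omega (T m omega)%:E = (mean (T m))%:E)%E.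
    by rewrite -(expectation_mean _ (bT m))// unlock.
  under eq_bigr do rewrite E.
  by rewrite sumEFin lee_fin.
have iZ : P.-integrable setT Z.
  apply/integrableP; split; first exact: ge0_emeasurable_sum.
  under eq_integral => omega _ do rewrite gee0_abs ?nneseries_ge0//.
  by rewrite (le_lt_trans Zfin)// ltry.
apply: filterS (integrable_ae measurableT iZ) => omega /(_ I) Zo.
apply: cvg_series_cvg_0; apply: nondecreasing_is_cvgn.
  by apply: nondecreasing_series => m _ _; exact: T0.
exists (fine (Z omega)) => _ [n _ <-].
rewrite -lee_fin fineK// /series/= -sumEFin.
by apply: nneseries_lim_ge => m _ _; exact: T0'.
Qed.

(** The variance of a sum of uncorrelated increments grows linearly, so the averages
    over the first [m^2] increments have summable variances. *)
Lemma strong_law_uncorrelated (X : nat -> Omega -> R) (C : R) : 0 <= C ->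
    (forall j, bounded_rv P measurable (X j)) ->
    {ae P, forall omega, forall j, `|X j omega| <= C} ->
    (forall n, mean (fun omega => (\sum_(j < n) X j omega) * X n omega) = 0) ->
  {ae P, forall omega, (fun k => k%:R^-1 * \sum_(j < k) X j omega) @ \oo --> (0 : R)}.
Proof.
move=> C0 bX XC XX.
pose S n omega := \sum_(j < n) X j omega.
have bS n : bounded_rv P measurable (S n) by exact: bounded_rv_sum.
have bX2 n : bounded_rv P measurable (fun omega => X n omega * X n omega).
  exact: bounded_rvM.
have bS2 n : bounded_rv P measurable (fun omega => S n omega * S n omega).
  exact: bounded_rvM.
have bSX n : bounded_rv P measurable (fun omega => 2 * (S n omega * X n omega)).
  by apply: bounded_rvZ; exact: bounded_rvM.
have X2 n : mean (fun omega => X n omega * X n omega) <= C ^+ 2.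
  apply: (mean_le_ae (G := measurable)) => //; first exact: sqr_ge0.
  apply: filterS XC => omega /(_ n) XnC.
  by rewrite normrM -expr2 lerXn2r// nnegrE.
have S2 n : mean (fun omega => S n omega * S n omega) <= C ^+ 2 * n%:R.
  elim: n => [|n IH].
    rewrite mulr0 (eq_mean P (Y := fun=> 0)) ?mean_cst// => omega.
    by rewrite /S big_ord0 mulr0.
  rewrite (eq_mean P (Y := fun omega => (S n omega * S n omega +
     2 * (S n omega * X n omega)) + X n omega * X n omega)); last first.
    by move=> omega; rewrite /S big_ord_recr /=; ring.
  rewrite (meanD (G := measurable))//; last exact: bounded_rvD.
  rewrite (meanD (G := measurable))// (meanZ (G := measurable))//; last first.
    exact: bounded_rvM.
  by rewrite XX mulr0 addr0 -[n.+1%:R]natr1 mulrDr mulr1 lerD.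
pose T m omega := (S (m.+1 ^ 2)%N omega / (m.+1 ^ 2)%:R) ^+ 2.
have TE m omega : T m omega = (m.+1%:R ^+ 4)^-1 *
    (S (m.+1 ^ 2)%N omega * S (m.+1 ^ 2)%N omega).
  by rewrite /T natrX; field.
have bT m : bounded_rv P measurable (T m).
  by rewrite (funext (TE m)); exact: bounded_rvZ.
have mT m : mean (T m) <= C ^+ 2 * (m.+1%:R ^+ 2)^-1.
  rewrite (eq_mean P (TE m)) (meanZ (G := measurable))//.
  rewrite mulrC ler_pdivrMr ?exprn_gt0// (le_trans (S2 _))// natrX.
  by rewrite le_eqVlt; apply/orP; left; apply/eqP; field.
have sumT n : \sum_(0 <= m < n) mean (T m) <= C ^+ 2 * 3.
  apply: (@le_trans _ _ (\sum_(0 <= m < n) C ^+ 2 * (m.+1%:R ^+ 2)^-1)).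
    by apply: ler_sum => m _.
  by rewrite -mulr_sumr ler_wpM2l ?sqr_ge0// sum_inv_sqr.
have := ae_cvg0_of_summable_means (fun m omega => sqr_ge0 _) bT sumT.
move: XC; apply: filterS2 => omega XC T0.
apply: (average_from_squares C0) => [k|].
  by rewrite big_ord_recr /= addrAC subrr add0r.
apply/cvgr0Pnorm_lt => e e0.
have e2 : 0 < e ^+ 2 by rewrite exprn_gt0.
have /cvgr0Pnorm_lt/(_ _ e2) := T0; apply: filterS => m.
rewrite /T ger0_norm ?sqr_ge0// -real_normK ?num_real// ltr_pXn2r// ?nnegrE//.
exact: ltW.
Qed.

End strong_law.

(** * Moments of the disturbance and runs of small disturbances *)

Lemma qform_borel (R : realType) n (M : 'M[R]_n) (U : set R) : measurable U ->
  borel R n (qform M @^-1` U).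
Proof.
move=> mU; pose T := g_sigma_algebraType (@open 'cV[R]_n).
suff : measurable_fun setT (qform M : T -> R).
  by move=> /(_ measurableT U mU); rewrite setTI.
have -> : qform M = fun y => \sum_k (\sum_i y i ord0 * M i k) * y k ord0.
  apply/funext => y; rewrite /qform mxE; apply: eq_bigr => k _; congr (_ * _).
  by rewrite mxE; apply: eq_bigr => i _; rewrite mxE.
apply: measurable_sum => k; apply: measurable_funM; last exact: coord_borel.
apply: measurable_sum => i; apply: measurable_funM => //; exact: coord_borel.
Qed.

Section iid_moments.
Context d (Omega : measurableType d) (R : realType) (P : probability Omega R).
Context (n : nat) (W : set 'cV[R]_n) (w : nat -> Omega -> 'cV[R]_n).
Hypotheses (W_bounded : bounded_set W) (w_random : random_vectors w)
  (w_indep : mutually_independent P w) (w_identical : identically_distributed P w)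
  (w_mean0 : forall (k : nat) (i : 'I_n), ('E_P[fun omega => w k omega i ord0] = 0)%E)
  (w_support : {ae P, forall omega, forall k : nat, W (w k omega)}).
Local Notation mean := (mean P).
Local Notation past := (past w).
Local Notation present := (present w).

Let past_m j : past j `<=` measurable.
Proof. exact: past_measurable. Qed.

Let present_m j : present j `<=` measurable.
Proof. exact: present_measurable. Qed.

Lemma bounded_rv_coord j i : bounded_rv P (present j) (fun omega => w j omega i ord0).
Proof.
split.
  move=> U mU; apply: sub_sigma_algebra.
  exists ((fun y : 'cV[R]_n => y i ord0) @^-1` U) => //.
  by apply: borel_continuous => //; exact: coord_continuous.
have [b _ Wb] := bounded_set_mx W_bounded; exists b.
apply: filterS w_support => omega /(_ j) /Wb; apply: le_trans.
exact: ler_mx_entry.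
Qed.

Lemma mean_past_present j X Z :
  bounded_rv P (past j) X -> bounded_rv P (present j) Z ->
  mean (fun omega => X omega * Z omega) = mean X * mean Z.
Proof.
move=> bX bZ; apply: (mean_indep (past_m (j := j)) (present_m (j := j))) => //.
by move=> A B; exact: past_present_indep.
Qed.

Lemma mean_coord j i : mean (fun omega => w j omega i ord0) = 0.
Proof.
apply: EFin_inj; rewrite -(expectation_mean (present_m (j := j))) ?w_mean0//.
exact: bounded_rv_coord.
Qed.

(** Entries that are [bounded_rv] stay so under matrix sums and products, which covers
    all predicted states and inputs. *)
Definition adapted j p q (Y : Omega -> 'M[R]_(p, q)) :=
  forall i k, bounded_rv P (past j) (fun omega => Y omega i k).

Lemma adapted_cst j p q (M : 'M[R]_(p, q)) : adapted j (fun=> M).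
Proof. by move=> i k; exact: bounded_rv_cst. Qed.

Lemma adaptedD j p q (Y Z : Omega -> 'M[R]_(p, q)) : adapted j Y -> adapted j Z ->
  adapted j (fun omega => Y omega + Z omega).
Proof.
move=> aY aZ i k; under eq_fun do rewrite mxE.
exact: bounded_rvD.
Qed.

Lemma adaptedM j p q r (Y : Omega -> 'M[R]_(p, q)) (Z : Omega -> 'M[R]_(q, r)) :
  adapted j Y -> adapted j Z -> adapted j (fun omega => Y omega *m Z omega).
Proof.
move=> aY aZ i k; under eq_fun do rewrite mxE.
by apply: bounded_rv_sum => l; exact: bounded_rvM.
Qed.

Lemma adapted_tr j p q (Y : Omega -> 'M[R]_(p, q)) : adapted j Y ->
  adapted j (fun omega => (Y omega)^T).
Proof. by move=> aY i k; under eq_fun do rewrite mxE; exact: aY. Qed.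

Lemma adaptedZ j p q X (Y : Omega -> 'M[R]_(p, q)) : bounded_rv P (past j) X ->
  adapted j Y -> adapted j (fun omega => X omega *: Y omega).
Proof.
by move=> bX aY i k; under eq_fun do rewrite mxE; exact: bounded_rvM.
Qed.

Lemma adapted_sum j p q (I : Type) (s : seq I) (Y : I -> Omega -> 'M[R]_(p, q)) :
  (forall i, adapted j (Y i)) -> adapted j (fun omega => \sum_(i <- s) Y i omega).
Proof.
move=> aY i k; under eq_fun do rewrite summxE.
by apply: bounded_rv_sum => l; exact: aY.
Qed.

Lemma adapted_disturbance j i : (i < j)%N -> adapted j (w i).
Proof.
move=> ij k l; rewrite (ord1 l); apply: sub_bounded_rv (bounded_rv_coord i k).
exact: present_past.
Qed.

Lemma adapted_le i j p q (Y : Omega -> 'M[R]_(p, q)) : (i <= j)%N ->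
  adapted i Y -> adapted j Y.
Proof. by move=> ij aY k l; apply: sub_bounded_rv (aY k l); exact: past_le. Qed.

Lemma adapted_bform j p q (M : 'M[R]_(p, q)) Y Z : adapted j Y -> adapted j Z ->
  bounded_rv P (past j) (fun omega => bform M (Y omega) (Z omega)).
Proof.
move=> aY aZ; apply: (adaptedM (Y := fun omega => (Y omega)^T *m M)) => //.
by apply: adaptedM; [exact: adapted_tr|exact: adapted_cst].
Qed.

Lemma adapted_qform j p (M : 'M[R]_p) Y : adapted j Y ->
  bounded_rv P (past j) (fun omega => qform M (Y omega)).
Proof. by move=> aY; exact: adapted_bform. Qed.

Lemma qform_present j (M : 'M[R]_n) :
  bounded_rv P (present j) (fun omega => qform M (w j omega)).
Proof.
split.
  move=> U mU; apply: sub_sigma_algebra.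
  by exists (qform M @^-1` U) => //; exact: qform_borel.
by have [_] := adapted_qform M (adapted_disturbance (leqnn j.+1)).
Qed.

Lemma mean_qform_identical j (M : 'M[R]_n) :
  mean (fun omega => qform M (w j omega)) = mean (fun omega => qform M (w 0%N omega)).
Proof.
apply: (mean_eq_law (present_m (j := j)) (present_m (j := 0%N))).
- exact: qform_present.
- exact: qform_present.
by move=> U mU; exact: (w_identical j (qform_borel M mU)).
Qed.

(** The coefficients depend on the past only, and the present disturbance is centred
    and independent of it. *)
Lemma mean_bform_present j p (M : 'M[R]_(p, n)) Y : adapted j Y ->
  mean (fun omega => bform M (Y omega) (w j omega)) = 0.
Proof.
move=> aY; have aYM : adapted j (fun omega => (Y omega)^T *m M).
  by apply: adaptedM; [exact: adapted_tr|exact: adapted_cst].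
rewrite (eq_mean P (Y := fun omega => \sum_k ((Y omega)^T *m M) ord0 k * w j omega k ord0));
  last by move=> omega; rewrite /bform mxE.
have aw := adapted_disturbance (leqnn j.+1).
rewrite (mean_sum (past_m (j := j.+1))); last first.
  move=> k; apply: bounded_rvM; last exact: aw.
  exact: (adapted_le (leqnSn j) aYM).
rewrite big1// => k _; rewrite (@mean_past_present j)//.
  by rewrite mean_coord mulr0.
exact: bounded_rv_coord.
Qed.

(** Terms linear in the present disturbance with past coefficients, and centred
    functions of the present disturbance, are orthogonal to the past. *)
Lemma mean_past_noise j p (M : 'M[R]_(p, n)) (M' : 'M[R]_n) s Y :
    bounded_rv P (past j) s -> adapted j Y ->
  mean (fun omega => s omega * (2 * bform M (Y omega) (w j omega) +
    (qform M' (w j omega) - mean (fun omega => qform M' (w 0%N omega))))) = 0.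
Proof.
move=> bs aY; set sigma := mean (fun omega => qform M' (w 0%N omega)).
have bq : bounded_rv P (present j) (fun omega => qform M' (w j omega) - sigma).
  by apply: bounded_rvB; [exact: qform_present|exact: bounded_rv_cst].
have sY : adapted j (fun omega => (2 * s omega) *: Y omega).
  by apply: adaptedZ => //; exact: bounded_rvZ.
rewrite (eq_mean P (Y := fun omega => bform M ((2 * s omega) *: Y omega) (w j omega) +
    s omega * (qform M' (w j omega) - sigma))); last first.
  by move=> omega; rewrite bformZl; ring.
have lift X : bounded_rv P (past j) X -> bounded_rv P (past j.+1) X.
  by apply: sub_bounded_rv; exact: past_le.
have lift' X : bounded_rv P (present j) X -> bounded_rv P (past j.+1) X.
  by apply: sub_bounded_rv; exact: present_past.
rewrite (meanD (past_m (j := j.+1))); last 2 first.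
- apply: adapted_bform; last exact: adapted_disturbance.
  exact: adapted_le sY.
- by apply: bounded_rvM; [exact: lift|exact: lift'].
rewrite mean_bform_present// add0r (mean_past_present bs bq).
rewrite (meanB (present_m (j := j))); [|exact: qform_present|exact: bounded_rv_cst].
by rewrite mean_cst mean_qform_identical subrr mulr0.
Qed.

Lemma mean_bform_linear p q (M : 'M[R]_(p, q)) (y : 'cV[R]_p)
    (H : nat -> 'M[R]_(q, n)) k :
  mean (fun omega => bform M y (\sum_(t < k) H t *m w t omega)) = 0.
Proof.
have aH t : (t < k)%N -> adapted k (fun omega => H t *m w t omega).
  by move=> tk; apply: adaptedM; [exact: adapted_cst|exact: adapted_disturbance].
rewrite (eq_mean P (Y := fun omega => \sum_(t < k) bform M y (H t *m w t omega))).
  rewrite (mean_sum (past_m (j := k))) => [|t].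
    rewrite big1// => t _.
    rewrite (eq_mean P (Y := fun omega => bform (M *m H t) y (w t omega))).
      by apply: (@mean_bform_present t); exact: adapted_cst.
    by move=> omega; rewrite /bform !mulmxA.
  by apply: adapted_bform; [exact: adapted_cst|exact: aH].
by move=> omega; rewrite [LHS]/bform mulmx_sumr summxE; apply: eq_bigr.
Qed.

(** The cross terms vanish because each disturbance is orthogonal to the earlier ones. *)
Lemma mean_qform_linear p (M : 'M[R]_p) (H : nat -> 'M[R]_(p, n)) k : M^T = M ->
  mean (fun omega => qform M (\sum_(t < k) H t *m w t omega)) =
  \sum_(t < k) mean (fun omega => qform M (H t *m w 0%N omega)).
Proof.
move=> sM; elim: k => [|k IH].
  rewrite big_ord0 (eq_mean P (Y := fun=> 0)) ?mean_cst// => omega.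
  by rewrite big_ord0 qform0.
pose y omega := \sum_(t < k) H t *m w t omega.
have ay : adapted k y.
  apply: adapted_sum => t; apply: adaptedM; first exact: adapted_cst.
  exact: adapted_disturbance.
have ay1 : adapted k.+1 y by exact: adapted_le ay.
have aw : adapted k.+1 (fun omega => H k *m w k omega).
  by apply: adaptedM; [exact: adapted_cst|exact: adapted_disturbance].
rewrite big_ord_recr /= -IH.
rewrite (eq_mean P (Y := fun omega => (qform M (y omega) +
    2 * bform M (y omega) (H k *m w k omega)) + qform M (H k *m w k omega))); last first.
  by move=> omega; rewrite big_ord_recr /= -/(y omega) qformD.
rewrite (meanD (past_m (j := k.+1))); last 2 first.
- apply: bounded_rvD; first exact: adapted_qform.
  by apply: bounded_rvZ; exact: adapted_bform.
- exact: adapted_qform.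
rewrite (meanD (past_m (j := k.+1))); last 2 first.
- exact: adapted_qform.
- by apply: bounded_rvZ; exact: adapted_bform.
rewrite (meanZ (past_m (j := k.+1))); last exact: adapted_bform.
have -> : mean (fun omega => bform M (y omega) (H k *m w k omega)) = 0.
  rewrite (eq_mean P (Y := fun omega => bform (M *m H k) (y omega) (w k omega))).
    exact: mean_bform_present.
  by move=> omega; rewrite /bform !mulmxA.
rewrite mulr0 addr0; congr (_ + _).
have E j : mean (fun omega => qform M (H k *m w j omega)) =
    mean (fun omega => qform ((H k)^T *m M *m H k) (w j omega)).
  by apply: eq_mean => omega; rewrite qform_mulmx.
by rewrite !E mean_qform_identical.
Qed.

(** Ordered by the time of the disturbance, a convolution is a linear combination of the
    disturbances with the coefficients reversed. *)
Lemma mean_qform_convolution p (M : 'M[R]_p) (H : nat -> 'M[R]_(p, n)) k : M^T = M ->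
  mean (fun omega => qform M (\sum_(j < k) H j *m w (k - j.+1)%N omega)) =
  \sum_(j < k) mean (fun omega => qform M (H j *m w 0%N omega)).
Proof.
move=> sM; rewrite (reindex_inj rev_ord_inj) /=.
rewrite -(mean_qform_linear (fun t => H (k - t.+1)%N))//.
apply: eq_mean => omega; congr qform.
rewrite (reindex_inj rev_ord_inj) /=; apply: eq_bigr => t _.
by rewrite subnSK// subKn// ltnW.
Qed.

Lemma mean_bform_convolution p q (M : 'M[R]_(p, q)) y (H : nat -> 'M[R]_(q, n)) k :
  mean (fun omega => bform M y (\sum_(j < k) H j *m w (k - j.+1)%N omega)) = 0.
Proof.
rewrite -(mean_bform_linear M y (fun t => H (k - t.+1)%N) k).
apply: eq_mean => omega; congr bform.
rewrite (reindex_inj rev_ord_inj) /=; apply: eq_bigr => t _.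
by rewrite subnSK// subKn// ltnW.
Qed.

End iid_moments.

Lemma bigcap_ord_recr (T : Type) (F : nat -> set T) k :
  \bigcap_(t in `I_k.+1) F t = \bigcap_(t in `I_k) F t `&` F k.
Proof.
apply/seteqP; split=> x.
  by move=> Fx; split=> [t tk|]; apply: Fx => //=; exact: ltnW.
by move=> [Fx Fk] t /=; rewrite ltnS leq_eqVlt => /orP[/eqP -> //|]; exact: Fx.
Qed.

Section waiting_time.
Context d (Omega : measurableType d) (R : realType) (P : probability Omega R).
Context (n : nat) (w : nat -> Omega -> 'cV[R]_n).
Hypotheses (w_random : random_vectors w) (w_indep : mutually_independent P w)
  (w_identical : identically_distributed P w).
Variables (U : set 'cV[R]_n) (r : nat).
Hypotheses (U_borel : borel R n U) (U_gt0 : (0 < P (w 0%N @^-1` U))%E).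

Definition run (j : nat) : set Omega :=
  \bigcap_(t in `I_r) (w (j + t)%N @^-1` U).

(** Runs are counted in consecutive disjoint blocks only, since these are independent. *)
Definition no_run (m : nat) : set Omega :=
  \bigcap_(b in `I_m) ~` run (b * r)%N.

Let pU := fine (P (w 0%N @^-1` U)).

(** Each further disturbance is independent of the past, hence contributes a factor
    [pU]. *)
Let run_in j k A : <<s past w j >> A ->
  <<s past w (j + k) >> (A `&` \bigcap_(t in `I_k) (w (j + t)%N @^-1` U)) /\
  P (A `&` \bigcap_(t in `I_k) (w (j + t)%N @^-1` U)) = (P A * (pU ^+ k)%:E)%E.
Proof.
move=> pA; elim: k => [|k [IH1 IH2]].
  by rewrite bigcap_mkord big_ord0 setIT addn0 expr0 mule1.
rewrite bigcap_ord_recr setIA.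
have pw : <<s present w (j + k) >> (w (j + k)%N @^-1` U).
  by apply: sub_sigma_algebra; exists U.
split.
  apply: (@measurableI _ (g_sigma_algebraType (past w (j + k.+1)))).
    by apply: past_le IH1; rewrite addnS.
  by apply: present_past pw; rewrite addnS.
rewrite (past_present_indep w_random w_indep IH1 pw) IH2 (w_identical (j + k) U_borel).
rewrite -muleA exprSr EFinM; congr (_ * (_ * _))%E.
by rewrite /pU fineK// fin_num_measure//; exact: w_random.
Qed.

Lemma no_run_prob m : <<s past w (m * r) >> (no_run m) /\
  P (no_run m) = ((1 - pU ^+ r) ^+ m)%:E.
Proof.
elim: m => [|m [IH1 IH2]].
  rewrite /no_run bigcap_mkord big_ord0 expr0 probability_setT; split => //.
  exact: (@measurableT _ (g_sigma_algebraType (past w (0 * r)))).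
have -> : no_run m.+1 = no_run m `\` (no_run m `&` run (m * r)%N).
  rewrite /no_run bigcap_ord_recr.
  apply/seteqP; split=> omega [a b]; split=> //; first by case.
  by move=> c; exact: b.
have [J1 J2] := run_in r IH1.
have mul : (m.+1 * r = m * r + r)%N by rewrite mulSn addnC.
have IH1' : <<s past w (m * r + r) >> (no_run m) by apply: past_le IH1; exact: leq_addr.
split.
  by rewrite mul; apply: (@measurableD _ (g_sigma_algebraType (past w (m * r + r)))).
have sm : <<s past w (m * r + r) >> `<=` measurable.
  apply: smallest_sub; first exact: sigma_algebra_measurable.
  exact: past_measurable.
rewrite measureD; [|exact: sm|exact: sm|].
  transitivity (P (no_run m) - P (no_run m `&` run (m * r)%N))%E.
    by rewrite setIA setIid.
  rewrite [X in (_ - X)%E]J2 IH2 -EFinM -EFinB; congr EFin.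
  by rewrite exprSr mulrBr mulr1.
by rewrite (le_lt_trans (probability_le1 _ (sm _ IH1')))// ltry.
Qed.

Lemma no_run_measurable m : measurable (no_run m).
Proof.
have [J _] := no_run_prob m; move: J; apply: smallest_sub.
  exact: sigma_algebra_measurable.
exact: past_measurable.
Qed.

Lemma no_run_cvg0 : (fun m => P (no_run m)) @ \oo --> 0%E.
Proof.
under eq_fun do rewrite (no_run_prob _).2.
apply: cvg_EFin; first exact: nearW.
have pU0 : 0 < pU.
  rewrite fine_gt0// U_gt0/=.
  by rewrite (le_lt_trans (probability_le1 _ (w_random 0%N U_borel)))// ltry.
have pU1 : pU <= 1.
  by rewrite -lee_fin fineK ?probability_le1// ?fin_num_measure//; exact: w_random.
have e1 : pU ^+ r <= 1 by rewrite exprn_ile1// ltW.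
have e0 : 0 < pU ^+ r by rewrite exprn_gt0.
apply: cvg_expr; rewrite ger0_norm ?subr_ge0//.
by rewrite ltrBlDr ltrDl.
Qed.

Lemma ae_run : {ae P, forall omega, exists b, run (b * r)%N omega}.
Proof.
apply: (negligibleS (A := \bigcap_m no_run m)).
  move=> omega nr m _ b /= bm rb; apply: nr; by exists b.
have mB : measurable (\bigcap_m no_run m).
  by apply: bigcapT_measurable => m; exact: no_run_measurable.
apply/negligibleP => //; apply/eqP; rewrite eq_le measure_ge0 andbT.
rewrite -(cvg_lim _ no_run_cvg0)//; apply: lime_ge.
  by apply/cvg_ex; exists 0%E; exact: no_run_cvg0.
apply: nearW => m; apply: le_measure; rewrite ?inE//; first exact: no_run_measurable.
by move=> omega; exact.
Qed.

End waiting_time.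

(** * The predicted cost as a function of the corrections *)

Section prediction_error.
Context {R : realType} {nx nu nw N : nat}.
Variables (A : 'M[R]_nx) (B : 'M[R]_(nx, nu)) (D : 'M[R]_(nx, nw)).
Variables (K : 'M[R]_(nu, nx)) (L : nat -> 'M[R]_(nu, nw)).
Hypothesis N_gt0 : (0 < N)%N.
Local Notation pred_state := (pred_state A B D K L).
Local Notation lag_gain := (lag_gain (N := N) L).
Local Notation feedback_error := (feedback_error L).

(** The effect of a disturbance on the state [j.+1] steps later, the feedback of the
    disturbance through the gains included. *)
Fixpoint impulse_response (j : nat) : 'M[R]_(nx, nw) :=
  if j is i.+1 then (A + B *m K) *m impulse_response i + B *m lag_gain i.+1 else D.

Lemma free_input_zero i : free_input ((fun=> 0) : 'I_N -> 'cV[R]_nu) i = 0.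
Proof. by rewrite /free_input; case: insub. Qed.

Lemma pred_error_convolution v i : pred_state 0 ((fun=> 0) : 'I_N -> _) v i =
  \sum_(j < i) impulse_response j *m v (i - j.+1)%N.
Proof.
elim: i => [|i IH]; first by rewrite big_ord0.
rewrite pred_stateS// IH big_ord_recl /= subn1 addrC; congr (_ + _).
rewrite /feedback_error free_input_zero add0r !mulmx_sumr -big_split.
apply: eq_bigr => j _ /=.
by rewrite /bump /= add1n subSS mulmxDl !mulmxA.
Qed.

Lemma feedback_error_late (c : 'I_N -> 'cV[R]_nu) i : (N <= i)%N ->
  feedback_error c (fun=> 0) i = 0.
Proof.
move=> Ni; rewrite /feedback_error free_input_ge// add0r big1// => j _.
by rewrite mulmx0.
Qed.

Lemma pred_nominal_cvg0 x (c : 'I_N -> 'cV[R]_nu) : stabilizing A B K ->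
  (fun i => pred_state x c (fun=> 0) i) @ \oo --> (0 : 'cV[R]_nx).
Proof.
move=> stab; apply: (stable_cvg0 (N := N) stab) => i Ni.
by rewrite pred_stateS// feedback_error_late// !mulmx0 !addr0.
Qed.

Lemma sum_lag_gain (V : zmodType) (h : 'M[R]_(nu, nw) -> V) i : h 0 = 0 ->
  (N <= i)%N ->
  \sum_(j < i) h (lag_gain j.+1) = \sum_(j < N) h (lag_gain j.+1).
Proof.
move=> h0 Ni; rewrite -!(big_mkord xpredT (fun j => h (lag_gain j.+1))).
rewrite (big_cat_nat (n := N))//= [X in _ + X]big_nat.
rewrite [X in _ + X]big1 ?addr0// => j /andP[Nj _].
by rewrite /lag_gain ltnNge (leq_trans Nj).
Qed.

Lemma feedback_error_bounded (r : R) : exists2 C : R, 0 <= C &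
  forall v : nat -> 'cV[R]_nw, (forall k, `|v k| <= r) ->
    forall i, `|feedback_error ((fun=> 0) : 'I_N -> _) v i| <= C.
Proof.
pose l j := nw%:R * `|lag_gain j.+1| * `|r|.
have l0 j : 0 <= l j by rewrite !mulr_ge0.
exists (\sum_(j < N) l j) => [|v vr i]; first exact: sumr_ge0.
rewrite /feedback_error free_input_zero add0r (le_trans (ler_norm_sum _ _ _))//.
apply: (@le_trans _ _ (\sum_(j < i) l j)).
  apply: ler_sum => j _; rewrite (le_trans (ler_norm_mulmx _ _))//.
  by rewrite ler_wpM2l ?mulr_ge0// (le_trans (vr _))// ler_norm.
have [Ni|iN] := leqP N i.
  rewrite (@sum_lag_gain _ (fun M => nw%:R * `|M| * `|r|))//.
  by rewrite normr0 mulr0 mul0r.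
rewrite -!(big_mkord xpredT l) [leRHS](big_cat_nat (n := i))//=; last exact: ltnW.
by rewrite lerDl sumr_ge0.
Qed.

End prediction_error.

Section prediction_cost.
Context d (Omega : measurableType d) (R : realType) (P : probability Omega R).
Context (nx nu nw N : nat).
Variables (A : 'M[R]_nx) (B : 'M[R]_(nx, nu)) (D : 'M[R]_(nx, nw)).
Variables (W : set 'cV[R]_nw) (w : nat -> Omega -> 'cV[R]_nw).
Hypotheses (W_bounded : bounded_set W) (w_random : random_vectors w)
  (w_indep : mutually_independent P w) (w_identical : identically_distributed P w)
  (w_mean0 : forall (k : nat) (i : 'I_nw),
     ('E_P[fun omega => w k omega i ord0] = 0)%E)
  (w_support : {ae P, forall omega, forall k : nat, W (w k omega)}).
Variables (Q S : 'M[R]_nx) (Ru : 'M[R]_nu) (K : 'M[R]_(nu, nx)).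
Hypotheses (Q_posdef : posdef Q) (Ru_posdef : posdef Ru) (S_sym : S^T = S).
Let Psi := Ru + B^T *m S *m B.
Hypotheses (S_unit : Psi \in unitmx)
  (S_riccati : S = Q + A^T *m S *m A - K^T *m Psi *m K)
  (K_def : K = - (invmx Psi *m B^T *m S *m A))
  (K_stabilizing : stabilizing A B K).
Hypothesis N_gt0 : (0 < N)%N.
Variable L : nat -> 'M[R]_(nu, nw).
Local Notation mean := (mean P).
Local Notation past := (past w).
Local Notation adapted := (adapted P w).
Local Notation H := (impulse_response (N := N) A B D K L).
Local Notation lag_gain := (lag_gain (N := N) L).

Let past_m j : past j `<=` measurable.
Proof. exact: past_measurable. Qed.

Let state x (c : 'I_N -> 'cV[R]_nu) i omega :=
  pred_state A B D K L x c (fun j => w j omega) i.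
Let nominal x (c : 'I_N -> 'cV[R]_nu) i := pred_state A B D K L x c (fun=> 0) i.
Let fberr (c : 'I_N -> 'cV[R]_nu) i omega :=
  feedback_error L c (fun j => w j omega) i.

Let adapted_fberr c i : adapted i (fberr c i).
Proof.
apply: adaptedD; first exact: adapted_cst.
case: i => [|i]; first by under eq_fun do rewrite big_ord0; exact: adapted_cst.
apply: adapted_sum => j; apply: adaptedM; first exact: adapted_cst.
apply: (adapted_disturbance W_bounded w_support).
by rewrite ltn_subrL.
Qed.

Let adapted_state x c i : adapted i (state x c i).
Proof.
elim: i => [|i IH]; first exact: adapted_cst.
rewrite /state; under eq_fun do rewrite pred_stateS//.
have aC p q (M : 'M[R]_(p, q)) r (Y : Omega -> 'M[R]_(q, r)) : adapted i.+1 Y ->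
    adapted i.+1 (fun omega => M *m Y omega).
  by move=> aY; apply: adaptedM => //; exact: adapted_cst.
have aw : adapted i.+1 (w i) by exact: (adapted_disturbance W_bounded w_support).
apply: adaptedD; last exact: aC.
by apply: adaptedD; apply: aC; [exact: adapted_le IH|exact: adapted_le (adapted_fberr c i)].
Qed.

Let sH j := mean (fun omega => qform S (H j *m w 0%N omega)).
Let sL j := mean (fun omega => qform Psi (lag_gain j.+1 *m w 0%N omega)).
Let sD := mean (fun omega => qform S (D *m w 0%N omega)).

Let S_ge0 x : 0 <= qform S x.
Proof. exact: (riccati_ge0 Q_posdef Ru_posdef S_sym S_unit S_riccati K_def). Qed.

Let Psi_sym : Psi^T = Psi.
Proof. exact: input_weight_sym. Qed.

(** The prediction error is a convolution of the disturbances, so it is centred and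
    its covariance does not depend on the state and the corrections. *)
Lemma mean_value_state x c i :
  mean (fun omega => qform S (state x c i omega)) =
  qform S (nominal x c i) + \sum_(j < i) sH j.
Proof.
pose y omega := \sum_(j < i) H j *m w (i - j.+1)%N omega.
have sE omega : state x c i omega = nominal x c i + y omega.
  by rewrite /state pred_state_split// pred_error_convolution.
have ay : adapted i y.
  have E : y = fun omega => state x c i omega - nominal x c i.
    by apply/funext => omega; rewrite sE addrC addKr.
  by rewrite E; apply: adaptedD => //; exact: adapted_cst.
rewrite (eq_mean P (Y := fun omega => (qform S (nominal x c i) +
    2 * bform S (nominal x c i) (y omega)) + qform S (y omega))); last first.
  by move=> omega; rewrite sE qformD.
have bb : bounded_rv P (past i) (fun omega => bform S (nominal x c i) (y omega)).
  by apply: adapted_bform => //; exact: adapted_cst.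
rewrite (meanD (past_m (j := i))); last 2 first.
- by apply: bounded_rvD; [exact: bounded_rv_cst|exact: bounded_rvZ].
- exact: adapted_qform.
rewrite (meanD (past_m (j := i))); last 2 first.
- exact: bounded_rv_cst.
- exact: bounded_rvZ.
rewrite mean_cst (meanZ (past_m (j := i)))//.
rewrite (mean_bform_convolution W_bounded)// mulr0 addr0.
by rewrite (mean_qform_convolution W_bounded).
Qed.

(** The accumulated variances increase, and they are bounded because bounded
    disturbances keep the states of the stabilised system bounded. *)
Lemma mean_value_cvg : exists s : R, forall x c,
  (fun i => mean (fun omega => qform S (state x c i omega))) @ \oo --> s.
Proof.
pose u i := \sum_(j < i) sH j.
have sH0 j : 0 <= sH j by apply: mean_ge0.
have [b b0 Wb] := bounded_set_mx W_bounded.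
have [Cf Cf0 fC] := feedback_error_bounded (N := N) L b.
pose beta := nu%:R * `|B| * Cf + nw%:R * `|D| * b.
have beta0 : 0 <= beta by rewrite addr_ge0// !mulr_ge0.
have [C HC] := lq_bounded_response Q_posdef Ru_posdef S_sym S_unit S_riccati K_def
  K_stabilizing 0 beta0.
have [C' C'0 SC'] := qform_bound S.
have uM i : u i <= C' * C ^+ 2.
  have := mean_value_state 0 (fun=> 0) i.
  have -> : nominal 0 (fun=> 0) i = 0.
    rewrite /nominal pred_error_convolution//.
    by rewrite big1// => j _; rewrite mulmx0.
  rewrite qform0 add0r -/(u i) => <-.
  apply: (mean_le_ae (past_m (j := i))).
  - by rewrite mulr_ge0// sqr_ge0.
  - exact: adapted_qform.
  apply: filterS w_support => omega Wo.
  rewrite (le_trans (SC' _))// ler_wpM2l//.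
  have sC : `|state 0 (fun=> 0) i omega| <= C.
    apply: (HC (fun i => state 0 (fun=> 0) i omega)
       (fun i => B *m fberr (fun=> 0) i omega + D *m w i omega)) => [|k|k].
    - by rewrite /state /= normr0.
    - rewrite (le_trans (ler_normD _ _))// lerD//.
        rewrite (le_trans (ler_norm_mulmx _ _))// ler_wpM2l ?mulr_ge0//.
        by apply: fC => j; exact: Wb.
      by rewrite (le_trans (ler_norm_mulmx _ _))// ler_wpM2l ?mulr_ge0// Wb.
    - by rewrite /state pred_stateS// addrA.
  have C0 : 0 <= C := le_trans (normr_ge0 _) sC.
  by rewrite lerXn2r// nnegrE.
have ucvg : cvgn u.
  apply: nondecreasing_is_cvgn.
    apply/nondecreasing_seqP => i.
    by rewrite /u big_ord_recr /= lerDl.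
  by exists (C' * C ^+ 2) => _ [i _ <-].
exists (limn u) => x c; under eq_fun do rewrite mean_value_state.
have -> : limn u = 0 + limn u by rewrite add0r.
apply: cvgD ucvg.
by apply: cvg_qform0; exact: pred_nominal_cvg0.
Qed.

Let stage x (c : 'I_N -> 'cV[R]_nu) i omega :=
  stage_cost A B D K L Q Ru w x c i omega.

Let input x c i omega := K *m state x c i omega + fberr c i omega.

Let stageE x c i omega :
  stage x c i omega = qform Q (state x c i omega) + qform Ru (input x c i omega).
Proof. by rewrite /stage /stage_cost pred_inputE. Qed.

Let adapted_input x c i : adapted i (input x c i).
Proof. by apply: adaptedD => //; apply: adaptedM => //; exact: adapted_cst. Qed.

Let adapted_stage x c i : bounded_rv P (past i) (stage x c i).
Proof.
rewrite (funext (stageE x c i)).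
by apply: bounded_rvD; apply: adapted_qform.
Qed.

Lemma mean_fberr c i : mean (fun omega => qform Psi (fberr c i omega)) =
  qform Psi (free_input c i) + \sum_(j < i) sL j.
Proof.
pose y omega := \sum_(j < i) lag_gain j.+1 *m w (i - j.+1)%N omega.
have fE omega : fberr c i omega = free_input c i + y omega by [].
have ay : adapted i y.
  have E : y = fun omega => fberr c i omega - free_input c i.
    by apply/funext => omega; rewrite fE addrC addKr.
  by rewrite E; apply: adaptedD => //; exact: adapted_cst.
rewrite (eq_mean P (Y := fun omega => (qform Psi (free_input c i) +
    2 * bform Psi (free_input c i) (y omega)) + qform Psi (y omega))); last first.
  by move=> omega; rewrite fE qformD.
have bb : bounded_rv P (past i) (fun omega => bform Psi (free_input c i) (y omega)).
  by apply: adapted_bform => //; exact: adapted_cst.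
rewrite (meanD (past_m (j := i))); last 2 first.
- by apply: bounded_rvD; [exact: bounded_rv_cst|exact: bounded_rvZ].
- exact: adapted_qform.
rewrite (meanD (past_m (j := i))); last 2 first.
- exact: bounded_rv_cst.
- exact: bounded_rvZ.
rewrite mean_cst (meanZ (past_m (j := i)))//.
rewrite (mean_bform_convolution W_bounded w_random _ _ w_support _ _
  (fun j => lag_gain j.+1))// mulr0 addr0.
by rewrite (mean_qform_convolution W_bounded _ _ _ _ _ (fun j => lag_gain j.+1)).
Qed.

(** The expectation of the completed square along the predicted trajectory. *)
Lemma mean_stage x c i : mean (stage x c i) =
  mean (fun omega => qform S (state x c i omega))
  - mean (fun omega => qform S (state x c i.+1 omega)) + sD
  + (qform Psi (free_input c i) + \sum_(j < i) sL j).
Proof.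
pose z omega := A *m state x c i omega + B *m input x c i omega.
have az : adapted i z.
  by apply: adaptedD; apply: adaptedM => //; exact: adapted_cst.
have next omega : state x c i.+1 omega = z omega + D *m w i omega.
  by rewrite /state /= pred_inputE.
have square omega : stage x c i omega + qform S (z omega) =
    qform S (state x c i omega) + qform Psi (fberr c i omega).
  rewrite stageE (completing_square Ru_posdef S_sym S_unit S_riccati K_def).
  congr (_ + qform _ _).
  by rewrite /input addrAC subrr add0r.
have bS j : bounded_rv P (past j) (fun omega => qform S (state x c j omega)).
  exact: adapted_qform.
have bz : bounded_rv P (past i) (fun omega => qform S (z omega)) by exact: adapted_qform.
have bf : bounded_rv P (past i) (fun omega => qform Psi (fberr c i omega)).
  exact: adapted_qform.
have m1 : mean (stage x c i) + mean (fun omega => qform S (z omega)) =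
    mean (fun omega => qform S (state x c i omega)) +
    mean (fun omega => qform Psi (fberr c i omega)).
  by rewrite -!(meanD (past_m (j := i)))//; apply: eq_mean.
have m2 : mean (fun omega => qform S (state x c i.+1 omega)) =
    mean (fun omega => qform S (z omega)) + sD.
  have aw : adapted i.+1 (w i).
    exact: (adapted_disturbance W_bounded w_support).
  have az1 : adapted i.+1 z by exact: adapted_le az.
  have aDw : adapted i.+1 (fun omega => D *m w i omega).
    by apply: adaptedM => //; exact: adapted_cst.
  rewrite (eq_mean P (Y := fun omega => (qform S (z omega) +
      2 * bform S (z omega) (D *m w i omega)) + qform S (D *m w i omega))); last first.
    by move=> omega; rewrite next qformD.
  have bb : bounded_rv P (past i.+1) (fun omega => bform S (z omega) (D *m w i omega)).
    exact: adapted_bform.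
  rewrite (meanD (past_m (j := i.+1))); last 2 first.
  - by apply: bounded_rvD; [exact: adapted_qform|exact: bounded_rvZ].
  - exact: adapted_qform.
  rewrite (meanD (past_m (j := i.+1))); last 2 first.
  - exact: adapted_qform.
  - exact: bounded_rvZ.
  rewrite (meanZ (past_m (j := i.+1)))//.
  have -> : mean (fun omega => bform S (z omega) (D *m w i omega)) = 0.
    rewrite (eq_mean P (Y := fun omega => bform (S *m D) (z omega) (w i omega))).
      exact: (mean_bform_present W_bounded w_random w_indep w_mean0 w_support).
    by move=> omega; rewrite /bform !mulmxA.
  rewrite mulr0 addr0 /sD; congr (_ + _).
  have E j : mean (fun omega => qform S (D *m w j omega)) =
      mean (fun omega => qform (D^T *m S *m D) (w j omega)).
    by apply: eq_mean => omega; rewrite qform_mulmx.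
  by rewrite !E (mean_qform_identical W_bounded).
rewrite -mean_fberr m2; move: m1; lra.
Qed.

Let rho := \sum_(j < N) sL j.

Let sL_late i : (N <= i)%N -> \sum_(j < i) sL j = rho.
Proof.
move=> Ni.
apply: (@sum_lag_gain _ _ _ _ L _
  (fun M => mean (fun omega => qform Psi (M *m w 0%N omega)))) => //.
rewrite (eq_mean P (Y := fun=> 0)) ?mean_cst// => omega.
by rewrite mul0mx qform0.
Qed.

Lemma mean_stage_cvg x c : (fun i => mean (stage x c i)) @ \oo --> sD + rho.
Proof.
have [s sP] := mean_value_cvg; have xs := sP x c.
under eq_fun do rewrite mean_stage.
have -> : sD + rho = s - s + sD + rho by rewrite subrr add0r.
apply: cvgD.
  apply: cvgD; last exact: cvg_cst.
  have xs' := xs; rewrite -cvg_shiftS /= in xs'.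
  exact: cvgB xs xs'.
apply: cvg_near_cst; exists N => // i /= Ni.
by rewrite free_input_ge// qform0 add0r sL_late.
Qed.

Lemma expectation_stage x c i : ('E_P[stage x c i] = (mean (stage x c i))%:E)%E.
Proof. exact: (expectation_mean (past_m (j := i)) (adapted_stage x c i)). Qed.

Lemma steady_costE x (c : 'I_N -> 'cV[R]_nu) :
  steady_cost P A B D K L Q Ru w x c = sD + rho.
Proof.
rewrite /steady_cost; apply: cvg_lim => //.
under eq_fun do rewrite expectation_stage /=.
exact: mean_stage_cvg.
Qed.

(** Completing the square telescopes the stage costs into the values of successive
    states; what the free inputs add to the optimum of the unconstrained problem is
    the quadratic cost of the corrections alone. *)
Theorem pred_cost_expansion : exists kappa : R, forall x (c : 'I_N -> 'cV[R]_nu),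
  pred_cost P A B D K L Q Ru w x c =
    (qform S x + correction_cost Psi c + kappa)%:E.
Proof.
have [s sP] := mean_value_cvg.
(* Before the horizon ends not all gains act yet: the terms of [tau] are what the
   feedback of the disturbances lacks, in the first stages, of its steady cost. *)
pose tau := \sum_(i < N) (\sum_(j < i) sL j - rho).
exists (tau - s) => x c; rewrite /pred_cost steady_costE.
set ell := sD + rho.
have partial n : (N <= n)%N ->
  ('E_P[fun omega => (\sum_(i < n) (stage x c i omega - ell))%R] =
   (qform S x + correction_cost Psi c + tau
    - mean (fun omega => qform S (state x c n omega)))%:E)%E.
  move=> Nn.
  have bst i : bounded_rv P (past (maxn n i)) (fun omega => stage x c i omega - ell).
    apply: bounded_rvB; last exact: bounded_rv_cst.
    by apply: sub_bounded_rv (adapted_stage x c i); apply: past_le; exact: leq_maxr.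
  have bst' (i : 'I_n) : bounded_rv P (past n) (fun omega => stage x c i omega - ell).
    by have := bst i; rewrite (maxn_idPl _)// ltnW.
  rewrite (expectation_mean (past_m (j := n))); last exact: bounded_rv_sum.
  congr EFin; rewrite (mean_sum (past_m (j := n)))//.
  have E (i : nat) : mean (fun omega => stage x c i omega - ell) =
      mean (fun omega => qform S (state x c i omega))
      - mean (fun omega => qform S (state x c i.+1 omega))
      + qform Psi (free_input c i) + (\sum_(j < i) sL j - rho).
    rewrite (meanB (past_m (j := i)))//; last exact: bounded_rv_cst.
    by rewrite mean_cst mean_stage /ell; ring.
  under eq_bigr do rewrite E.
  rewrite 2!big_split /=.
  have -> : \sum_(i < n) (mean (fun omega => qform S (state x c i omega))
      - mean (fun omega => qform S (state x c i.+1 omega))) =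
      qform S x - mean (fun omega => qform S (state x c n omega)).
    rewrite -(big_mkord xpredT (fun i => mean (fun omega => qform S (state x c i omega))
      - mean (fun omega => qform S (state x c i.+1 omega)))).
    under eq_bigr do rewrite -opprB.
    rewrite sumrN telescope_sumr// opprB; congr (_ - _).
    by rewrite -[RHS](mean_cst P); apply: eq_mean.
  have -> : \sum_(i < n) qform Psi (free_input c i) = correction_cost Psi c.
    rewrite -(big_mkord xpredT (fun i => qform Psi (free_input c i))).
    rewrite (big_cat_nat (n := N))//= [X in _ + X]big_nat.
    rewrite [X in _ + X]big1 ?addr0 => [|j /andP[Nj _]]; last first.
      by rewrite free_input_ge// qform0.
    by rewrite big_mkord; apply: eq_bigr => i _; rewrite free_inputE.
  have -> : \sum_(i < n) (\sum_(j < i) sL j - rho) = tau.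
    rewrite -(big_mkord xpredT (fun i => \sum_(j < i) sL j - rho)).
    rewrite (big_cat_nat (n := N))//= [X in _ + X]big_nat.
    rewrite [X in _ + X]big1 ?addr0 => [|j /andP[Nj _]]; last first.
      by rewrite sL_late// subrr.
    by rewrite big_mkord.
  by ring.
apply: cvg_lim => //.
have lim_real : (fun n => qform S x + correction_cost Psi c + tau
    - mean (fun omega => qform S (state x c n omega))) @ \oo -->
    qform S x + correction_cost Psi c + (tau - s).
  by rewrite addrA; apply: cvgB; [exact: cvg_cst|exact: sP].
apply: cvg_EFin; first by exists N => // n /= Nn; rewrite partial.
apply: cvg_trans lim_real; apply: near_eq_cvg; exists N => // n /= Nn.
by rewrite partial.
Qed.

End prediction_cost.

(** * Chance constraints as half-spaces *)

Section linear_forms.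
Context {R : realType}.

Lemma linear_form_coord n (phi : 'cV[R]_n -> R) :
    (forall a y y', phi (y + a *: y') = phi y + a * phi y') ->
  forall y, phi y = \sum_l phi (delta_mx l 0) * y l ord0.
Proof.
move=> lin y.
have phi0 : phi 0 = 0.
  have := lin 1 0 0; rewrite scaler0 addr0 mul1r => /eqP.
  by rewrite -subr_eq0 opprD addrA subrr add0r oppr_eq0 => /eqP.
have {1}-> : y = \sum_l y l ord0 *: delta_mx l 0.
  by rewrite {1}[y]matrix_sum_delta; apply: eq_bigr => l _; rewrite big_ord1.
apply: (@etrans _ _ (\sum_l y l ord0 * phi (delta_mx l 0))); last first.
  by apply: eq_bigr => l _; rewrite mulrC.
elim/big_rec2: _ => [//|l s u _ IH].
by rewrite [_ + u]addrC lin IH addrC.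
Qed.

Lemma linear_form_bound n (phi : 'cV[R]_n -> R) :
    (forall a y y', phi (y + a *: y') = phi y + a * phi y') ->
  exists2 C : R, 0 <= C & forall y, `|phi y| <= C * `|y|.
Proof.
move=> lin; exists (\sum_l `|phi (delta_mx l 0)|) => [|y]; first exact: sumr_ge0.
rewrite [in leLHS](linear_form_coord lin) (le_trans (ler_norm_sum _ _ _))// mulr_suml.
by apply: ler_sum => l _; rewrite normrM ler_wpM2l// ler_mx_entry.
Qed.

Definition halfspace n (a : 'rV[R]_n) (r : R) : set 'cV[R]_n :=
  [set y | (a *m y) ord0 ord0 <= r].

Lemma halfspace_borel n (a : 'rV[R]_n) (r : R) : borel R n (halfspace a r).
Proof.
pose T := g_sigma_algebraType (@open 'cV[R]_n).
suff : measurable_fun setT ((fun y => (a *m y) ord0 ord0) : T -> R).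
  move=> /(_ measurableT `]-oo, r]%classic (measurable_itv _)); rewrite setTI.
  by congr (measurable _); apply/seteqP; split => y; rewrite /= in_itv.
rewrite (_ : (fun y => _) = fun y : T => \sum_k a ord0 k * (y : 'cV[R]_n) k ord0).
  by apply: measurable_sum => k; apply: measurable_funM => //; exact: coord_borel.
by apply/funext => y; rewrite mxE.
Qed.

Lemma halfspace_le n (a : 'rV[R]_n) (r s : R) : r <= s -> halfspace a r `<=` halfspace a s.
Proof. by move=> rs y /le_trans; exact. Qed.

End linear_forms.

Section stacked_inputs.
Context {R : realType} {nu N : nat}.

(** A plan as one column vector, on which the cost of the corrections is a quadratic
    form and rank arguments apply. *)
Definition unstack (y : 'cV[R]_(N * nu)) (i : 'I_N) : 'cV[R]_nu :=
  rowsub (mxvec_index i) y.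

Definition stack (c : 'I_N -> 'cV[R]_nu) : 'cV[R]_(N * nu) :=
  (mxvec (\matrix_(i, k) c i k ord0))^T.

Lemma stackK c : unstack (stack c) = c.
Proof.
apply/funext => i; apply/matrixP => k l.
by rewrite (ord1 l) mxE mxE mxvecE mxE.
Qed.

Lemma unstack_lin a y y' :
  unstack (y + a *: y') = fun i => unstack y i + a *: unstack y' i.
Proof. by apply/funext => i; apply/matrixP => k l; rewrite !mxE. Qed.

Definition stacked_weight (Psi : 'M[R]_nu) : 'M[R]_(N * nu) :=
  \sum_(i < N) (rowsub (mxvec_index i) 1%:M)^T *m Psi *m rowsub (mxvec_index i) 1%:M.

Lemma stacked_weightE Psi y :
  qform (stacked_weight Psi) y = correction_cost Psi (unstack y).
Proof.
rewrite /stacked_weight /correction_cost /qform mulmx_sumr mulmx_suml summxE.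
apply: eq_bigr => i _; rewrite /unstack.
have -> : rowsub (mxvec_index i) y = rowsub (mxvec_index i) 1%:M *m y.
  by rewrite mul_rowsub_mx mul1mx.
by rewrite -/(qform _ _) -/(qform _ _) qform_mulmx.
Qed.

Lemma stacked_weight_posdef Psi : posdef Psi -> posdef (stacked_weight Psi).
Proof.
move=> pPsi; have [sPsi _] := pPsi; split.
  rewrite /stacked_weight linear_sum; apply: eq_bigr => i _ /=.
  by rewrite !trmx_mul trmxK sPsi mulmxA.
move=> y y0; rewrite stacked_weightE.
rewrite lt_neqAle sumr_ge0 ?andbT => [|i _]; last exact: posdef_ge0.
apply: contraNneq y0 => /esym/eqP; rewrite psumr_eq0 => [/allP yi|i _]; last exact: posdef_ge0.
apply/eqP/matrixP => l k; rewrite (ord1 k) [RHS]mxE.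
case/mxvec_indexP: l => i j.
have /eqP/(posdef_eq0 pPsi) := yi i (mem_index_enum i).
by move/matrixP/(_ j ord0); rewrite !mxE.
Qed.

Lemma norm_unstack y i : `|unstack y i| <= `|y|.
Proof. by apply: mx_norm_le => // k l; rewrite mxE ler_mx_entry. Qed.

End stacked_inputs.

Section constraints.
Context d (Omega : measurableType d) (R : realType) (P : probability Omega R).
Context (nx nu nw N : nat).
Variables (A : 'M[R]_nx) (B : 'M[R]_(nx, nu)) (D : 'M[R]_(nx, nw)).
Variables (K : 'M[R]_(nu, nx)) (L : nat -> 'M[R]_(nu, nw)).
Variables (W : set 'cV[R]_nw) (w : nat -> Omega -> 'cV[R]_nw).
Hypotheses (w_random : random_vectors w) (w_identical : identically_distributed P w).
Hypothesis N_gt0 : (0 < N)%N.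
Implicit Types (c : 'I_N -> 'cV[R]_nu) (x : 'cV[R]_nx).

(** The left-hand side of a constraint without the disturbance [f'Dw] that enters it;
    the probability bears on that disturbance alone. *)
Definition constraint_value (f : 'cV[R]_nx) (g : 'cV[R]_nu)
    (x : 'cV[R]_nx) (u : 'cV[R]_nu) : R :=
  (f^T *m (A *m x + B *m u) + g^T *m u) ord0 ord0.

Definition nominal_value f g (i : nat) x c :=
  constraint_value f g (pred_state A B D K L x c (fun=> 0) i)
    (pred_input K L c (fun=> 0) i (pred_state A B D K L x c (fun=> 0) i)).

Lemma constraint_value_lin f g a x x' u u' :
  constraint_value f g (x + a *: x') (u + a *: u') =
  constraint_value f g x u + a * constraint_value f g x' u'.
Proof.
rewrite /constraint_value.
have -> : A *m (x + a *: x') + B *m (u + a *: u') =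
    (A *m x + B *m u) + a *: (A *m x' + B *m u').
  by rewrite !mulmxDr -!scalemxAr scalerDr addrACA.
move: (A *m x + B *m u) (A *m x' + B *m u') => z z'.
have -> : f^T *m (z + a *: z') + g^T *m (u + a *: u') =
    (f^T *m z + g^T *m u) + a *: (f^T *m z' + g^T *m u').
  by rewrite !mulmxDr -!scalemxAr scalerDr addrACA.
by rewrite mxE [X in _ + X = _]mxE.
Qed.

Lemma nominal_value_lin f g i a x x' c c' :
  nominal_value f g i (x + a *: x') (fun j => c j + a *: c' j) =
  nominal_value f g i x c + a * nominal_value f g i x' c'.
Proof.
rewrite /nominal_value -constraint_value_lin !pred_inputE//.
have -> : (fun=> 0) = (fun j : nat => (0 : 'cV[R]_nw) + a *: 0).
  by apply/funext => j; rewrite scaler0 addr0.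
rewrite pred_state_lin// feedback_error_lin.
have <- : (fun=> 0) = (fun j : nat => (0 : 'cV[R]_nw) + a *: 0).
  by apply/funext => j; rewrite scaler0 addr0.
congr constraint_value.
move: (feedback_error L c _ i) (feedback_error L c' _ i) => e e'.
by rewrite mulmxDr -scalemxAr scalerDr addrACA.
Qed.

Lemma constraint_atP f g p x c i : constraint_at P A B D K L W w f g p x c i <->
  forall v : nat -> 'cV[R]_nw, (forall j : nat, (j < i)%N -> W (v j)) ->
    (p%:E <= P (w i @^-1` halfspace (f^T *m D)
      (1 - constraint_value f g (pred_state A B D K L x c v i)
        (pred_input K L c v i (pred_state A B D K L x c v i)))))%E.
Proof.
suff E v : let xi := pred_state A B D K L x c v i in
    let ui := pred_input K L c v i xi in
    [set omega | ((f^T *m (A *m xi + B *m ui + D *m w i omega) + g^T *m ui) ord0 ord0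
         <= 1)%R] =
    w i @^-1` halfspace (f^T *m D) (1 - constraint_value f g xi ui).
  by split => H v Wv; have := H v Wv; rewrite /= E.
move=> xi ui; apply/seteqP; rewrite /halfspace /constraint_value.
have E omega : (f^T *m (A *m xi + B *m ui + D *m w i omega) + g^T *m ui) ord0 ord0 =
    (f^T *m (A *m xi + B *m ui) + g^T *m ui) ord0 ord0 + (f^T *m D *m w i omega) ord0 ord0.
  by rewrite mulmxDr addrAC mulmxA mxE.
by split=> omega /=; rewrite E lerBrDl.
Qed.

Lemma constraint_value_split f g x c v i :
  constraint_value f g (pred_state A B D K L x c v i)
    (pred_input K L c v i (pred_state A B D K L x c v i)) =
  nominal_value f g i x c +
  constraint_value f g (pred_state A B D K L 0 ((fun=> 0) : 'I_N -> _) v i)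
    (pred_input K L ((fun=> 0) : 'I_N -> _) v i
      (pred_state A B D K L 0 ((fun=> 0) : 'I_N -> _) v i)).
Proof.
rewrite /nominal_value -[X in _ + X]mul1r -constraint_value_lin !scale1r.
rewrite !pred_inputE// [in LHS]pred_state_split// [in LHS]feedback_error_split.
by rewrite mulmxDr addrACA.
Qed.

(** The disturbances shift a constraint independently of [x] and [c], so the
    constraint only restricts its nominal value from above. *)
Lemma constraint_at_le f g p i x c x' c' :
    nominal_value f g i x' c' <= nominal_value f g i x c ->
  constraint_at P A B D K L W w f g p x c i ->
  constraint_at P A B D K L W w f g p x' c' i.
Proof.
move=> le /constraint_atP H; apply/constraint_atP => v Wv.
apply: (le_trans (H v Wv)); apply: le_measure; rewrite ?inE.
- by apply: w_random; exact: halfspace_borel.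
- by apply: w_random; exact: halfspace_borel.
apply: preimage_subset; apply: halfspace_le.
rewrite lerD2l lerN2 (constraint_value_split f g x' c').
by rewrite (constraint_value_split f g x c) lerD2r.
Qed.

(** Feeding back the realised disturbance turns the tail of a feasible plan into a
    feasible plan at the next state. *)
Lemma constraint_at_shift f g p x c v i : W v ->
  constraint_at P A B D K L W w f g p x c i.+1 ->
  constraint_at P A B D K L W w f g p
    (A *m x + B *m (K *m x + c (Ordinal N_gt0)) + D *m v)
    (shifted_input L c v) i.
Proof.
move=> Wv /constraint_atP H; apply/constraint_atP => v' Wv'.
pose vv j := if j is j'.+1 then v' j' else v.
have := H vv; rewrite pred_input_shift pred_state_shift /=.
move=> /(_ _)/le_trans; apply; first by case=> [|j] //; exact: Wv'.
have b r : borel R nw (halfspace (f^T *m D) r) by exact: halfspace_borel.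
by rewrite !(w_identical _ (b _)).
Qed.

Section bounded_corrections.
Context (m N2 : nat).
Variables (f : 'I_m -> 'cV[R]_nx) (g : 'I_m -> 'cV[R]_nu) (p : 'I_m -> R).
Local Notation feasible := (feasible P A B D K L W w f g p N2).
Local Notation X := (feasible_set P N A B D K L W w f g p N2).
Variable Psi : 'M[R]_nu.
Hypothesis Psi_posdef : posdef Psi.
Hypothesis X_bounded : bounded_set X.
Variable cstar : 'cV[R]_nx -> 'I_N -> 'cV[R]_nu.
Hypothesis cstar_feasible : forall x, X x -> feasible x (cstar x).
Hypothesis cstar_minimal : forall x, X x -> forall c, feasible x c ->
  correction_cost Psi (cstar x) <= correction_cost Psi c.

Let I : finType := ('I_m * 'I_(N + N2))%type.
Let value (q : I) x c := nominal_value (f q.1) (g q.1) q.2 x c.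
Let admissible (q : I) x c :=
  constraint_at P A B D K L W w (f q.1) (g q.1) (p q.1) x c q.2.
(** Admissibility is monotone in the nominal value. A constraint is active when its value
    is the largest admissible one, which is then the same for all states. *)
Let active (q : I) x :=
  forall x' c, admissible q x' c -> value q x' c <= value q x (cstar x).
Let activeset x : {set I} := [set q | `[< active q x >]].

Let form (q : I) (y : 'cV[R]_(N * nu)) := value q 0 (unstack y).

Let form_lin q a y y' : form q (y + a *: y') = form q y + a * form q y'.
Proof.
by rewrite /form unstack_lin -nominal_value_lin scaler0 addr0.
Qed.

Let value_split q x c : value q x c = value q x (fun=> 0) + value q 0 c.
Proof.
rewrite -[X in _ + X]mul1r -nominal_value_lin scaler0 addr0; congr (value q x).
by apply/funext => j; rewrite add0r scale1r.
Qed.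

Let forms (a : {set I}) : 'M[R]_(#|I|, N * nu) :=
  \matrix_(k, l) if enum_val k \in a then form (enum_val k) (delta_mx l 0) else 0.

Let formsE a y k : (forms a *m y) k ord0 =
  if enum_val k \in a then form (enum_val k) y else 0.
Proof.
rewrite mxE (linear_form_coord (form_lin (enum_val k)) y).
case: ifP => ka; first by apply: eq_bigr => l _; rewrite mxE ka.
by rewrite big1// => l _; rewrite mxE ka mul0r.
Qed.

Let feasible_admissible x c : feasible x c <-> forall q, admissible q x c.
Proof.
by split => [H q|H l i iN]; [exact: H|exact: (H (l, Ordinal iN))].
Qed.

(** Moving the optimal corrections along a direction that leaves the active
    constraints unchanged keeps them feasible, so the optimum is orthogonal to it. *)
Let cstar_orthogonal x h : X x -> forms (activeset x) *m h = 0 ->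
  bform (stacked_weight Psi) h (stack (cstar x)) = 0.
Proof.
move=> Xx Gh.
(* An inactive constraint leaves room for a small displacement in any direction. *)
pose slack (q : I) (t : R) := q \notin activeset x ->
    exists x' c, admissible q x' c /\
      value q x (cstar x) + t * form q h <= value q x' c.
have small : \forall t \near (0 : R), forall q, slack q t.
  apply: (@filter_forall R I slack (nbhs (0 : R)) (nbhs_filter _)) => q.
  rewrite /slack; case: (boolP (q \in activeset x)) => qa.
    by apply: nearW => t; rewrite ?qa.
  have [x' [c [adm gap]]] : exists x' c, admissible q x' c /\
      value q x (cstar x) < value q x' c.
    apply: contrapT => none; move: qa; rewrite inE => /asboolPn; apply=> x' c adm.
    by rewrite leNgt; apply/negP => lt; apply: none; exists x', c.
  have tcvg : (fun t : R => value q x (cstar x) + t * form q h) @ (0 : R) -->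
      value q x (cstar x) + 0 * form q h.
    by apply: cvgD; [exact: cvg_cst|apply: cvgM; [exact: cvg_id|exact: cvg_cst]].
  rewrite mul0r addr0 in tcvg.
  have := @cvgr_lt _ _ _ (nbhs_filter (0 : R)) _ _ tcvg _ gap.
  apply: (@filterS R (nbhs (0 : R)) (nbhs_filter _)) => t lt _.
  by exists x', c; split => //; exact: ltW.
have /nbhs_ballP[e /= e0 small'] := small.
apply: (orthogonal_of_minimal (e := e)) => //.
  by have [] := stacked_weight_posdef (N := N) Psi_posdef.
move=> t te; rewrite !stacked_weightE unstack_lin stackK.
apply: cstar_minimal => //; apply/feasible_admissible => q.
have lt : value q x (fun j => cstar x j + t *: unstack h j) =
    value q x (cstar x) + t * form q h.
  by rewrite -nominal_value_lin scaler0 addr0.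
have [qa|qa] := boolP (q \in activeset x).
  apply: constraint_at_le ((feasible_admissible _ _).1 (cstar_feasible Xx) q).
  rewrite -/(value q x _) -/(value q x _) lt.
  have := formsE (activeset x) h (enum_rank q); rewrite enum_rankK qa Gh mxE => <-.
  by rewrite mulr0 addr0.
have tb : ball (0 : R) e t by rewrite -ball_normE /= sub0r normrN.
have [x' [c [adm le]]] := small' t tb q qa.
by apply: constraint_at_le adm; rewrite -/(value q x _) lt.
Qed.

Let active_value_bounded q : exists M : R, forall x, X x -> active q x ->
  `|value q x (cstar x)| <= M.
Proof.
have [[x1 [X1 a1]]|none] := pselect (exists x, X x /\ active q x); last first.
  by exists 0 => x Xx ax; exfalso; apply: none; exists x.
exists `|value q x1 (cstar x1)| => x Xx ax.
have adm y : X y -> admissible q y (cstar y).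
  by move=> Xy; exact: ((feasible_admissible _ _).1 (cstar_feasible Xy) q).
suff -> : value q x (cstar x) = value q x1 (cstar x1) by [].
by apply/eqP; rewrite eq_le a1 ?ax//; exact: adm.
Qed.

(** The optimal corrections are orthogonal to all directions on which the active
    constraints do not depend, hence determined linearly by the contribution of the
    corrections to the values of these constraints. That contribution is a constant
    minus a linear function of the bounded state, and there are only finitely many
    active sets. *)
Theorem optimal_corrections_bounded :
  exists C : R, forall x, X x -> forall i, `|cstar x i| <= C.
Proof.
have [b b0 Xb] := bounded_set_mx X_bounded.
have /choice[beta betaP] := active_value_bounded.
have /choice[gamma gammaP] : forall q, exists C : R,
    0 <= C /\ forall x, `|value q x (fun=> 0)| <= C * `|x|.
  move=> q; suff lin a y y' :
      value q (y + a *: y') (fun=> 0) = value q y (fun=> 0) + a * value q y' (fun=> 0).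
    by have [C C0 HC] := linear_form_bound lin; exists C.
  rewrite /value -nominal_value_lin; congr nominal_value.
  by apply/funext => j; rewrite scaler0 addr0.
have /choice[C CP] : forall a : {set I}, exists C : R, 0 <= C /\ forall y,
    (forall h, forms a *m h = 0 -> bform (stacked_weight Psi) h y = 0) ->
    `|y| <= C * `|forms a *m y|.
  move=> a; have [C C0 HC] := orthogonal_kernel_bound (forms a)
    (stacked_weight_posdef (N := N) Psi_posdef).
  by exists C.
pose M := \sum_q (`|beta q| + gamma q * b).
have M0 : 0 <= M.
  apply: sumr_ge0 => q _; have [g0 _] := gammaP q.
  by rewrite addr_ge0// mulr_ge0.
exists ((\sum_a C a) * M) => x Xx i.
rewrite -[cstar x]stackK (le_trans (norm_unstack _ i))//.
set y := stack _; set a := activeset x.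
have [Ca0 Ca] := CP a.
rewrite (le_trans (Ca y (fun h => @cstar_orthogonal x h Xx)))//.
have Cle : C a <= \sum_a C a.
  by rewrite (bigD1 a)//= lerDl sumr_ge0// => a' _; have [] := CP a'.
rewrite ler_pM//; apply: mx_norm_le => // k j; rewrite (ord1 j) formsE.
case: ifP => [qa|_]; last by rewrite normr0.
set q := enum_val k in qa *.
have act : active q x by move: qa; rewrite inE => /asboolP.
have -> : form q y = value q x (cstar x) - value q x (fun=> 0).
  by rewrite [value q x (cstar x)]value_split addrC addKr /form stackK.
have [g0 gP] := gammaP q.
rewrite (le_trans (ler_normB _ _))// (@le_trans _ _ (`|beta q| + gamma q * b))//.
  rewrite lerD//; first by rewrite (le_trans (betaP q x Xx act))// ler_norm.
  by rewrite (le_trans (gP x))// ler_wpM2l// Xb.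
rewrite /M (bigD1 q)//= lerDl sumr_ge0// => q' _; have [g0' _] := gammaP q'.
by rewrite addr_ge0// mulr_ge0.
Qed.

End bounded_corrections.

End constraints.

(** * Closed-loop trajectories and averaged costs *)

Section trajectories.
Context {R : realType} {nx nw : nat}.
Variable F : 'cV[R]_nx -> 'cV[R]_nw -> 'cV[R]_nx.

Lemma trajectoryD x v k t : trajectory F x v (k + t) =
  trajectory F (trajectory F x v k) (fun j => v (k + j)%N) t.
Proof. by elim: t => [|t IH]; rewrite ?addn0// addnS /= IH. Qed.

Lemma trajectory_invariant (X : set 'cV[R]_nx) (W : set 'cV[R]_nw) x v :
  (forall x v, X x -> W v -> X (F x v)) -> X x -> (forall k, W (v k)) ->
  forall k, X (trajectory F x v k).
Proof. by move=> FX Xx Wv; elim=> [|k IH] //=; exact: FX. Qed.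

(** Outside a ball around the origin the decrease of [U] exceeds what small
    disturbances add, which a nonnegative [U] bounded on [X] allows only finitely often. *)
Lemma lyapunov_entrance (X : set 'cV[R]_nx) (W : set 'cV[R]_nw)
    (U : 'cV[R]_nx -> R) (q C M e : R) :
    0 < q -> 0 <= C -> 0 < e ->
    (forall x v, X x -> W v -> X (F x v)) ->
    (forall x, X x -> 0 <= U x <= M) ->
    (forall x v, X x -> W v -> `|v| <= 1 ->
       U (F x v) <= U x - q * `|x| ^+ 2 + C * `|v|) ->
  exists (n : nat) (lambda : R), 0 < lambda /\ forall x v, X x ->
    (forall k, W (v k)) -> (forall t, (t < n.+1)%N -> `|v t| <= lambda) ->
    exists2 t, (t < n.+1)%N & `|trajectory F x v t| < e.
Proof.
move=> q0 C0 e0 FX UM Udec.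
pose delta := q * e ^+ 2 / 2.
have d0 : 0 < delta by rewrite divr_gt0// mulr_gt0// exprn_gt0.
pose lambda := Num.min 1 (delta / (C + 1)).
have l0 : 0 < lambda by rewrite lt_min ltr01 divr_gt0// ltr_wpDl.
have Cl : C * lambda <= delta.
  apply: (@le_trans _ _ ((C + 1) * lambda)); first by rewrite ler_wpM2r ?lerDl// ltW.
  by rewrite mulrC -ler_pdivlMr ?ltr_wpDl// ge_min lexx orbT.
pose n := Num.bound (`|M| / delta).
have nM : `|M| < n.+1%:R * delta.
  rewrite -ltr_pdivrMr// (lt_trans (archi_boundP _)) ?(divr_ge0 _ (ltW d0))//.
  by rewrite ltr_nat.
exists n, lambda; split => // x v Xx Wv vl.
apply: contrapT => none.
have far t : (t < n.+1)%N -> e <= `|trajectory F x v t|.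
  by move=> tn; rewrite leNgt; apply/negP => te; apply: none; exists t.
have Xt := trajectory_invariant FX Xx Wv.
have dec t : (t <= n.+1)%N -> U (trajectory F x v t) <= U x - t%:R * delta.
  elim: t => [|t IH] tn; first by rewrite mul0r subr0.
  have v1 : `|v t| <= 1 by rewrite (le_trans (vl _ tn))// ge_min lexx.
  rewrite /= (le_trans (Udec _ _ (Xt t) (Wv t) v1))//.
  have := IH (ltnW tn).
  have : e ^+ 2 <= `|trajectory F x v t| ^+ 2.
    by rewrite lerXn2r ?nnegrE ?(ltW e0)//; exact: far.
  move=> /(ler_wpM2l (ltW q0)).
  have -> : q * e ^+ 2 = 2 * delta by rewrite /delta; field.
  have : C * `|v t| <= delta by rewrite (le_trans _ Cl)// ler_wpM2l// vl.
  by rewrite -[t.+1%:R]natr1; lra.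
have := dec n.+1 (leqnn _).
have /andP[U0 _] := UM _ (Xt n.+1); have /andP[_ UxM] := UM _ Xx.
have := ler_norm M; lra.
Qed.

End trajectories.

Section average_transfer.
Context {R : realType}.

Lemma bounded_average_cvg0 (s : nat -> R) (M : R) : (forall k, `|s k| <= M) ->
  (fun k => k%:R^-1 * s k) @ \oo --> (0 : R).
Proof.
move=> sM; apply/cvgr0Pnorm_lt => e e0.
have M0 : 0 <= M := le_trans (normr_ge0 _) (sM 0%N).
exists (Num.bound (M / e)).+1 => // k /= Mk.
have k0 : 0 < k%:R :> R by rewrite ltr0n (leq_ltn_trans _ Mk).
rewrite normrM gtr0_norm ?invr_gt0// mulrC ltr_pdivrMr// (le_lt_trans (sM k))//.
rewrite mulrC -ltr_pdivrMr// (lt_trans (archi_boundP _)) ?(divr_ge0 M0 (ltW e0))//.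
by rewrite ltr_nat.
Qed.

(** The averages of a null sequence vanish, and moving the range of summation by one
    costs a single bounded term. *)
Lemma average_transfer (a b : nat -> R) (M l : R) :
    (forall k, `|b k| <= M) ->
    (fun k => k%:R^-1 * \sum_(j < k) b j) @ \oo --> l ->
    (fun k => a k - b k) @ \oo --> (0 : R) ->
  (fun k => k%:R^-1 * \sum_(1 <= j < k.+1) a j) @ \oo --> l.
Proof.
move=> bM bl ab.
rewrite -(cvg_shiftS (fun k => k%:R^-1 * \sum_(1 <= j < k.+1) a j)) /=.
have ab' : (fun k => a k.+1 - b k.+1) @ \oo --> (0 : R).
  by have := ab; rewrite -(cvg_shiftS (fun k => a k - b k)).
have ces := cesaro ab'.
have bl' : (fun k => k.+1%:R^-1 * \sum_(j < k.+1) b j) @ \oo --> l.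
  by have := bl; rewrite -(cvg_shiftS (fun k => k%:R^-1 * \sum_(j < k) b j)).
have edge : (fun k => k.+1%:R^-1 * (b k.+1 - b 0%N)) @ \oo --> (0 : R).
  have := bounded_average_cvg0 (s := fun k => b k - b 0%N) (M := M + M).
  rewrite -(cvg_shiftS (fun k => k%:R^-1 * (b k - b 0%N))); apply=> k.
  by rewrite (le_trans (ler_normB _ _))// lerD.
have lim : (fun k => k.+1%:R^-1 * \sum_(j < k.+1) b j + k.+1%:R^-1 * (b k.+1 - b 0%N)
    + arithmetic_mean (fun k => a k.+1 - b k.+1) k) @ \oo --> l.
  rewrite -[l]addr0; apply: cvgD ces; rewrite -[l]addr0; exact: cvgD edge.
apply: cvg_trans lim; apply: near_eq_cvg.
apply: nearW => k /=; rewrite /arithmetic_mean /= -!mulrDr; congr (_ * _).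
rewrite /series/= big_add1 /= sumrB -!(big_mkord xpredT b).
have <- : \sum_(0 <= j < k.+1) b j + (b k.+1 - b 0%N) = \sum_(0 <= j < k.+1) b j.+1.
  have Er : \sum_(0 <= j < k.+2) b j = \sum_(0 <= j < k.+1) b j + b k.+1.
    by rewrite big_nat_recr.
  have El : \sum_(0 <= j < k.+2) b j = b 0%N + \sum_(0 <= j < k.+1) b j.+1.
    by rewrite big_nat_recl.
  by move: Er; rewrite El => E; rewrite addrA -E addrAC subrr add0r.
by rewrite addrC subrK.
Qed.

End average_transfer.

Section linear_closed_loop.
Context d (Omega : measurableType d) (R : realType) (P : probability Omega R).
Context (nx nu nw : nat).
Variables (A : 'M[R]_nx) (B : 'M[R]_(nx, nu)) (D : 'M[R]_(nx, nw)).
Variables (W : set 'cV[R]_nw) (w : nat -> Omega -> 'cV[R]_nw).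
Hypotheses (W_bounded : bounded_set W) (w_random : random_vectors w)
  (w_indep : mutually_independent P w) (w_identical : identically_distributed P w)
  (w_mean0 : forall (k : nat) (i : 'I_nw),
     ('E_P[fun omega => w k omega i ord0] = 0)%E)
  (w_support : {ae P, forall omega, forall k : nat, W (w k omega)}).
Variables (Q S : 'M[R]_nx) (Ru : 'M[R]_nu) (K : 'M[R]_(nu, nx)).
Hypotheses (Q_posdef : posdef Q) (Ru_posdef : posdef Ru) (S_sym : S^T = S).
Let Psi := Ru + B^T *m S *m B.
Hypotheses (S_unit : Psi \in unitmx)
  (S_riccati : S = Q + A^T *m S *m A - K^T *m Psi *m K)
  (K_def : K = - (invmx Psi *m B^T *m S *m A))
  (K_stabilizing : stabilizing A B K).
Local Notation mean := (mean P).
Variable x0 : 'cV[R]_nx.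
Let step (x : 'cV[R]_nx) (v : 'cV[R]_nw) := (A + B *m K) *m x + D *m v.
Let xi k omega := trajectory step x0 (fun j => w j omega) k.
Let cost x := qform Q x + qform Ru (K *m x).

Definition steady_state_cost : R :=
  mean (fun omega => qform (D^T *m S *m D) (w 0%N omega)).

Lemma linear_trajectory_bounded : exists2 C : R, 0 <= C &
  forall v, (forall k, W (v k)) -> forall k, `|trajectory step x0 v k| <= C.
Proof.
have [b b0 Wb] := bounded_set_mx W_bounded.
have beta0 : 0 <= nw%:R * `|D| * b :> R by rewrite !mulr_ge0.
have [C HC] := lq_bounded_response Q_posdef Ru_posdef S_sym S_unit S_riccati K_def
  K_stabilizing `|x0| beta0.
exists `|C| => // v Wv k; apply: (le_trans _ (ler_norm C)).
apply: (HC (trajectory step x0 v) (fun k => D *m v k)) => // j.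
by rewrite (le_trans (ler_norm_mulmx _ _))// ler_wpM2l ?mulr_ge0// Wb.
Qed.

Let adapted_xi k : adapted P w k (xi k).
Proof.
elim: k => [|k IH]; first exact: adapted_cst.
apply: adaptedD.
  by apply: adaptedM; [exact: adapted_cst|exact: adapted_le IH].
by apply: adaptedM; [exact: adapted_cst|exact: (adapted_disturbance W_bounded w_support)].
Qed.

Let noise k omega := 2 * bform (S *m D) ((A + B *m K) *m xi k omega) (w k omega)
  + (qform (D^T *m S *m D) (w k omega) - steady_state_cost).

Let cost_noise k omega : cost (xi k omega) =
  qform S (xi k omega) - qform S (xi k.+1 omega) + noise k omega + steady_state_cost.
Proof.
rewrite (lyapunov_equation Ru_posdef S_sym S_unit S_riccati K_def (xi k omega)) -/(cost _).
have -> : xi k.+1 omega = (A + B *m K) *m xi k omega + D *m w k omega by [].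
rewrite qformD// (qform_mulmx S D) /noise.
have -> : bform S ((A + B *m K) *m xi k omega) (D *m w k omega) =
    bform (S *m D) ((A + B *m K) *m xi k omega) (w k omega) by rewrite /bform !mulmxA.
lra.
Qed.

(** The Lyapunov equation turns the stage costs into a telescoping sum plus a constant
    plus noise that is orthogonal to the past. *)
Theorem linear_average_cost : {ae P, forall omega,
  (fun k => k%:R^-1 * \sum_(j < k) cost (xi j omega)) @ \oo --> steady_state_cost}.
Proof.
have [b b0 Wb] := bounded_set_mx W_bounded.
have [Cx Cx0 xC] := linear_trajectory_bounded.
have [C1 C10 H1] := bform_bound (S *m D).
have [C2 C20 H2] := qform_bound (D^T *m S *m D).
have [C3 C30 H3] := qform_bound S.
pose C := 2 * (C1 * (nx%:R * `|A + B *m K| * Cx * b))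
  + (C2 * b ^+ 2 + `|steady_state_cost|).
have C0 : 0 <= C by rewrite !addr_ge0 ?mulr_ge0// sqr_ge0.
have aw k : adapted P w k.+1 (w k) by exact: (adapted_disturbance W_bounded w_support).
have an k : bounded_rv P (past w k.+1) (noise k).
  apply: bounded_rvD.
    apply: bounded_rvZ; apply: adapted_bform => //.
    by apply: adaptedM; [exact: adapted_cst|exact: adapted_le (adapted_xi k)].
  by apply: bounded_rvB; [exact: adapted_qform|exact: bounded_rv_cst].
have mn k : bounded_rv P measurable (noise k).
  apply: sub_bounded_rv (an k); apply: sub_sigma => E pE.
  by apply: sub_sigma_algebra; exact: past_measurable pE.
have nC : {ae P, forall omega, forall j, `|noise j omega| <= C}.
  apply: filterS w_support => omega Wo j.
  have wb : `|w j omega| <= b by exact: Wb.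
  have xb : `|xi j omega| <= Cx by apply: xC.
  rewrite (le_trans (ler_normD _ _))// lerD//.
    rewrite normrM ger0_norm// ler_pM2l// (le_trans (H1 _ _))// ler_wpM2l//.
    rewrite ler_pM ?normr_ge0//.
    by rewrite (le_trans (ler_norm_mulmx _ _))// ler_wpM2l ?mulr_ge0.
  rewrite (le_trans (ler_normB _ _))// lerD2r (le_trans (H2 _))// ler_wpM2l//.
  by rewrite lerXn2r// nnegrE.
have ortho n : mean (fun omega => (\sum_(j < n) noise j omega) * noise n omega) = 0.
  apply: (mean_past_noise W_bounded w_random w_indep w_identical w_mean0 w_support).
    have bj (j : 'I_n) : bounded_rv P (past w n) (noise j).
      by apply: sub_bounded_rv (an j); exact: past_le.
    exact: bounded_rv_sum.
  by apply: adaptedM; [exact: adapted_cst|exact: adapted_xi].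
have := strong_law_uncorrelated C0 mn nC ortho.
move: w_support; apply: filterS2 => omega Wo avg.
have edge : (fun k => k%:R^-1 * (qform S (xi 0%N omega) - qform S (xi k omega)))
    @ \oo --> (0 : R).
  have xb k : `|qform S (xi k omega)| <= C3 * Cx ^+ 2.
    by rewrite (le_trans (H3 _))// ler_wpM2l// lerXn2r ?nnegrE//; exact: xC.
  apply: (bounded_average_cvg0 (M := C3 * Cx ^+ 2 + C3 * Cx ^+ 2)) => k.
  by rewrite (le_trans (ler_normB _ _))// lerD.
have lim : (fun k => k%:R^-1 * (qform S (xi 0%N omega) - qform S (xi k omega))
    + k%:R^-1 * (\sum_(j < k) noise j omega) + steady_state_cost) @ \oo -->
    0 + 0 + steady_state_cost.
  by apply: cvgD; [exact: cvgD|exact: cvg_cst].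
rewrite !add0r in lim.
apply: cvg_trans lim; apply: near_eq_cvg; exists 1%N => // k /= k0.
under [in RHS]eq_bigr do rewrite cost_noise.
rewrite [in RHS]big_split [in RHS]big_split /= sumr_const card_ord.
have -> : \sum_(i < k) (qform S (xi i omega) - qform S (xi i.+1 omega)) =
    qform S (xi 0%N omega) - qform S (xi k omega).
  rewrite -(big_mkord xpredT (fun i => qform S (xi i omega) - qform S (xi i.+1 omega))).
  under eq_bigr do rewrite -opprB.
  by rewrite sumrN telescope_sumr// opprB.
rewrite -mulrDr [RHS]mulrDr; congr (_ + _).
by rewrite -[X in _ * X]mulr_natl mulrA mulVf ?mul1r// pnatr_eq0 -lt0n.
Qed.

End linear_closed_loop.

(** * The receding horizon controller *)

Section receding_horizon.
Context d (Omega : measurableType d) (R : realType) (P : probability Omega R).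
Context (nx nu nw : nat).
Variables (A : 'M[R]_nx) (B : 'M[R]_(nx, nu)) (D : 'M[R]_(nx, nw)).
Variables (W : set 'cV[R]_nw) (w : nat -> Omega -> 'cV[R]_nw).
Hypotheses (w_random : random_vectors w) (w_identical : identically_distributed P w).
Variables (Q S : 'M[R]_nx) (Ru : 'M[R]_nu) (K : 'M[R]_(nu, nx)).
Hypotheses (Q_posdef : posdef Q) (Ru_posdef : posdef Ru) (S_sym : S^T = S).
Let Psi := Ru + B^T *m S *m B.
Hypotheses (S_unit : Psi \in unitmx)
  (S_riccati : S = Q + A^T *m S *m A - K^T *m Psi *m K)
  (K_def : K = - (invmx Psi *m B^T *m S *m A))
  (K_stabilizing : stabilizing A B K).
Variables (m : nat) (f : 'I_m -> 'cV[R]_nx) (g : 'I_m -> 'cV[R]_nu) (p : 'I_m -> R).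
Variables (N : nat) (N_gt0 : (0 < N)%N) (L : nat -> 'M[R]_(nu, nw)) (N2 : nat).
Local Notation feasible := (feasible P A B D K L W w f g p N2).
Local Notation X := (feasible_set P N A B D K L W w f g p N2).
Hypothesis N2_large : forall x (c : 'I_N -> 'cV[R]_nu), feasible x c ->
  forall l i, constraint_at P A B D K L W w (f l) (g l) (p l) x c i.
Hypothesis X_bounded : bounded_set X.
Variable cstar : 'cV[R]_nx -> 'I_N -> 'cV[R]_nu.
Hypothesis cstar_feasible : forall x, X x -> feasible x (cstar x).
Hypothesis cstar_minimal : forall x, X x -> forall c : 'I_N -> 'cV[R]_nu, feasible x c ->
  correction_cost Psi (cstar x) <= correction_cost Psi c.

Definition closed_loop (x : 'cV[R]_nx) (v : 'cV[R]_nw) : 'cV[R]_nx :=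
  A *m x + B *m (K *m x + cstar x (Ordinal N_gt0)) + D *m v.

Lemma shifted_input_feasible x v : X x -> W v ->
  feasible (closed_loop x v) (shifted_input L (cstar x) v).
Proof.
move=> Xx Wv l i _; apply: constraint_at_shift => //.
exact: N2_large (cstar_feasible Xx) l i.+1.
Qed.

Lemma recursive_feasibility x v : X x -> W v -> X (closed_loop x v).
Proof.
by move=> Xx Wv; exists (shifted_input L (cstar x) v); exact: shifted_input_feasible.
Qed.

(** The optimal cost, up to a constant, is a Lyapunov function of the closed loop: the
    decrease of the cost of the corrections pays for the input applied, and what is
    left is the stage cost and a term proportional to the disturbance. *)
Lemma optimal_cost_decrease : exists (M C : R), 0 <= C /\
  (forall x, X x -> 0 <= qform S x + correction_cost Psi (cstar x) <= M) /\
  (forall x v, X x -> W v -> `|v| <= 1 ->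
    qform S (closed_loop x v) + correction_cost Psi (cstar (closed_loop x v)) <=
    qform S x + correction_cost Psi (cstar x) - qform Q x + C * `|v|).
Proof.
have pPsi : posdef Psi := input_weight_posdef Q_posdef Ru_posdef S_sym S_unit S_riccati
  K_def K_stabilizing.
have S0 x : 0 <= qform S x := riccati_ge0 Q_posdef Ru_posdef S_sym S_unit S_riccati
  K_def K_stabilizing x.
have [sPsi _] := pPsi.
have [b b0 Xb] := bounded_set_mx X_bounded.
have [c cC] := optimal_corrections_bounded w_random N_gt0 pPsi X_bounded cstar_feasible
  cstar_minimal.
have [C1 C10 shift] := correction_cost_shift (N := N) L N_gt0 c sPsi.
have [C2 C20 H2] := bform_bound (S *m D).
have [C3 C30 H3] := qform_bound (D^T *m S *m D).
have [C4 C40 H4] := qform_bound S.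
have [C5 C50 H5] := qform_bound Psi.
pose z := nx%:R * `|A| * b + nu%:R * `|B| * (nx%:R * `|K| * b + `|c|).
have z0 : 0 <= z by rewrite !(addr_ge0, mulr_ge0).
exists (C4 * b ^+ 2 + \sum_(i < N) C5 * `|c| ^+ 2), (C1 + (2 * (C2 * z) + C3)); split.
  by rewrite !(addr_ge0, mulr_ge0).
split=> [x Xx|x v Xx Wv v1].
  apply/andP; split.
    by rewrite addr_ge0// sumr_ge0// => i _; exact: posdef_ge0.
  rewrite lerD//.
    rewrite (le_trans (ler_norm _))// (le_trans (H4 _))// ler_wpM2l//.
    by rewrite lerXn2r ?nnegrE//; exact: Xb.
  apply: ler_sum => i _; rewrite (le_trans (ler_norm _))// (le_trans (H5 _))//.
  by rewrite ler_wpM2l// lerXn2r ?nnegrE// (le_trans (cC x Xx i))// ler_norm.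
set u := K *m x + cstar x (Ordinal N_gt0).
have zb : `|A *m x + B *m u| <= z.
  rewrite (le_trans (ler_normD _ _))// lerD//.
    by rewrite (le_trans (ler_norm_mulmx _ _))// ler_wpM2l ?mulr_ge0//; exact: Xb.
  rewrite (le_trans (ler_norm_mulmx _ _))// ler_wpM2l ?mulr_ge0//.
  rewrite (le_trans (ler_normD _ _))// lerD//.
    by rewrite (le_trans (ler_norm_mulmx _ _))// ler_wpM2l ?mulr_ge0//; exact: Xb.
  by rewrite (le_trans (cC x Xx _))// ler_norm.
have square := completing_square Ru_posdef S_sym S_unit S_riccati K_def x u.
have uK : u - K *m x = cstar x (Ordinal N_gt0) by rewrite /u addrAC subrr add0r.
rewrite uK -/Psi in square.
have Ru0 := posdef_ge0 u Ru_posdef.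
have next : qform S (closed_loop x v) <=
    qform S (A *m x + B *m u) + (2 * (C2 * z) + C3) * `|v|.
  rewrite /closed_loop -/u qformD// -addrA lerD2l [leRHS]mulrDl lerD//.
    have -> : bform S (A *m x + B *m u) (D *m v) = bform (S *m D) (A *m x + B *m u) v.
      by rewrite /bform !mulmxA.
    rewrite -mulrA ler_pM2l// (le_trans (ler_norm _))// (le_trans (H2 _ _))//.
    by rewrite -mulrA ler_wpM2l// ler_wpM2r.
  rewrite qform_mulmx (le_trans (ler_norm _))// (le_trans (H3 _))// ler_wpM2l//.
  by rewrite expr2 ler_piMr.
have Vs := cstar_minimal (recursive_feasibility Xx Wv) (shifted_input_feasible Xx Wv).
have := shift (cstar x) v (cC x Xx) v1.
rewrite mulrDl; lra.
Qed.

Lemma closed_loop_entrance (e : R) : 0 < e ->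
  exists (n : nat) (lambda : R), 0 < lambda /\ forall x v, X x ->
    (forall k, W (v k)) -> (forall t, (t < n.+1)%N -> `|v t| <= lambda) ->
    exists2 t, (t < n.+1)%N & `|trajectory closed_loop x v t| < e.
Proof.
move=> e0; have [M [C [C0 [UM Udec]]]] := optimal_cost_decrease.
have [q q0 qQ] := posdef_lower_bound Q_posdef.
apply: (lyapunov_entrance (W := W) q0 C0 e0 recursive_feasibility UM) => x v Xx Wv v1.
by rewrite (le_trans (Udec x v Xx Wv v1))// lerD2r lerD2l lerN2.
Qed.

End receding_horizon.

(** The complements of the [G m] are measurable and, up to null sets, contained in the
    events in question, so they bound inner probabilities from below. *)
Lemma inner_prob_cvg1 d (Omega : measurableType d) (R : realType)
    (P : probability Omega R) (E : nat -> set Omega) (G : nat -> set Omega) (r : nat) :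
    (forall m, measurable (G m)) -> (fun m => P (G m)) @ \oo --> 0%E ->
    (forall m k, (m * r.+1 <= k)%N -> {ae P, forall omega, ~ G m omega -> E k omega}) ->
  (fun k => inner_prob P (E k)) @ \oo --> 1%E.
Proof.
move=> mG G0 GE.
have lim : (fun k => P (~` G (k %/ r.+1)%N)) @ \oo --> 1%E.
  have -> : (1%E : \bar R) = (1 - 0)%E by rewrite sube0.
  have lim0 : (fun k => P (G (k %/ r.+1)%N)) @ \oo --> 0%E.
    apply: cvg_comp G0; exact: cvg_divnr.
  rewrite (_ : (fun k => P _) = fun k => (1 - P (G (k %/ r.+1)%N))%E).
    by apply: cvgeB => //; exact: cvg_cst.
  by apply/funext => k; rewrite probability_setC.
apply: (squeeze_cvge _ lim (@cvg_cst _ _ _ _ _)); apply: nearW => k.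
apply/andP; split; last first.
  by apply: ge_ereal_sup => _ [F [mF _] <-]; exact: probability_le1.
have [Z [mZ Z0 ZE]] := GE _ _ (leq_divM k r.+1).
set m := (k %/ r.+1)%N in ZE *.
apply: (@le_trans _ _ (P (~` G m `\` Z))).
  rewrite measureD//=; last 2 first.
  - exact: measurableC.
  - by rewrite (le_lt_trans (probability_le1 _ _)) ?ltry//; exact: measurableC.
  rewrite (_ : P (_ `&` Z) = 0%E) ?sube0//.
  apply/eqP; rewrite eq_le measure_ge0 andbT -[leRHS]Z0.
  by apply: le_measure; rewrite ?inE//; apply: measurableI => //; exact: measurableC.
apply: ereal_sup_ubound; exists (~` G m `\` Z) => //; split.
  by apply: measurableD => //; exact: measurableC.
move=> omega [nG nZ]; apply: contrapT => nE; apply: nZ; apply: ZE => /= H.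
by apply: nE; exact: H.
Qed.

Theorem theorem7
  (R : realType) (d : measure_display) (Omega : measurableType d)
  (P : probability Omega R)
  (nx nu nw : nat)
  (A : 'M[R]_nx) (B : 'M[R]_(nx, nu)) (D : 'M[R]_(nx, nw))
  (AB_stabilizable : stabilizable A B)
  (* disturbance *)
  (W : set 'cV[R]_nw) (w : nat -> Omega -> 'cV[R]_nw)
  (W_bounded : bounded_set W)
  (W_interior : interior W 0)
  (w_random : random_vectors w)
  (w_independent : mutually_independent P w)
  (w_identical : identically_distributed P w)
  (w_mean0 : forall (k : nat) (i : 'I_nw), ('E_P[fun omega => w k omega i ord0] = 0)%E)
  (w_nonsingular : forall k : nat, nonsingular_law P (w k))
  (w_support : {ae P, forall omega, forall k : nat, W (w k omega)})
  (w_small : forall (k : nat) (lambda : R), 0 < lambda ->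
     (0 < P [set omega | (`|w k omega| <= lambda)%R])%E)
  (* weights and stabilizing gain *)
  (Q : 'M[R]_nx) (Ru : 'M[R]_nu) (S : 'M[R]_nx) (K : 'M[R]_(nu, nx))
  (Q_posdef : posdef Q) (Ru_posdef : posdef Ru)
  (S_sym : S^T = S)
  (S_unit : (Ru + B^T *m S *m B) \in unitmx)
  (S_riccati : S = Q + A^T *m S *m A - K^T *m (Ru + B^T *m S *m B) *m K)
  (K_def : K = - (invmx (Ru + B^T *m S *m B) *m B^T *m S *m A))
  (K_stabilizing : stabilizing A B K)
  (PhiD_controllable : controllable (A + B *m K) D)
  (* probabilistic constraints *)
  (m : nat) (m_gt0 : (0 < m)%N)
  (f : 'I_m -> 'cV[R]_nx) (g : 'I_m -> 'cV[R]_nu) (p : 'I_m -> R)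
  (p_range : forall l, 0 < p l <= 1)
  (* prediction horizon *)
  (N : nat) (N_gt0 : (0 < N)%N) (L : nat -> 'M[R]_(nu, nw)) (N2 : nat)
  (N2_large : forall (x : 'cV[R]_nx) (c : 'I_N -> 'cV[R]_nu),
     feasible P A B D K L W w f g p N2 x c ->
     forall (l : 'I_m) (i : nat),
       constraint_at P A B D K L W w (f l) (g l) (p l) x c i) :
  let X := feasible_set P N A B D K L W w f g p N2 in
  let J := pred_cost (N := N) P A B D K L Q Ru w in
  forall (X_bounded : bounded_set X)
    (* optimal solution of the optimal control problem *)
    (cstar : 'cV[R]_nx -> 'I_N -> 'cV[R]_nu)
    (cstar_feasible : forall x, X x ->
       feasible P A B D K L W w f g p N2 x (cstar x))
    (cstar_optimal : forall x, X x -> forall c : 'I_N -> 'cV[R]_nu,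
       feasible P A B D K L W w f g p N2 x c -> (J x (cstar x) <= J x c)%E),
  let c0star := fun x => cstar x (Ordinal N_gt0) in
  let Xf := [set x | X x /\ c0star x = 0] in
  forall
    (* near the origin the constraints are inactive (dropping them does not
       change the optimum) and c0star vanishes *)
    (inactive_near0 : \forall x \near (0 : 'cV[R]_nx),
       [/\ X x, (forall c : 'I_N -> 'cV[R]_nu, (J x (cstar x) <= J x c)%E)
         & c0star x = 0])
    (Xf_invariant : forall x v, Xf x -> W v ->
       Xf (A *m x + B *m (K *m x + c0star x) + D *m v))
    (x0 : 'cV[R]_nx) (X_x0 : X x0),
  let law := fun x : 'cV[R]_nx => K *m x + c0star x in
  let xk := fun (k : nat) (omega : Omega) =>
    trajectory (fun x v => A *m x + B *m law x + D *m v) x0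
      (fun j : nat => w j omega) k in
  let uk := fun (k : nat) (omega : Omega) => law (xk k omega) in
  let xik := fun (k : nat) (omega : Omega) =>
    trajectory (fun x v => (A + B *m K) *m x + D *m v) x0
      (fun j : nat => w j omega) k in
  (fun k : nat =>
     inner_prob P [set omega | minkowski_series (A + B *m K) D W (xk k omega)])
    @ \oo --> 1%E
  /\
  exists lss : R,
    (fun k : nat =>
       'E_P[fun omega => qform (Q + K^T *m Ru *m K)%R (xik k omega)]%E)
      @ \oo --> lss%:E
    /\
    {ae P, forall omega,
       (fun k : nat => k%:R^-1 *
          \sum_(1 <= j < k.+1) (qform Q (xk j omega) + qform Ru (uk j omega)))
         @ \oo --> lss}.
Proof.
move=> X J X_bounded cstar cstar_feasible cstar_optimal c0star Xf inactive_near0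
  Xf_invariant x0 X_x0 law xk uk xik.
pose Psi := Ru + B^T *m S *m B.
have [kappa costE] := pred_cost_expansion D W_bounded w_random w_independent w_identical
  w_mean0 w_support Q_posdef Ru_posdef S_sym S_unit S_riccati K_def K_stabilizing N_gt0 L.
have cstar_minimal x : X x -> forall c : 'I_N -> 'cV[R]_nu,
    feasible P A B D K L W w f g p N2 x c ->
    correction_cost Psi (cstar x) <= correction_cost Psi c.
  move=> Xx c /(cstar_optimal x Xx c); rewrite /J !costE lee_fin.
  by rewrite lerD2r lerD2l.
pose F := closed_loop A B D K N_gt0 cstar.
have FX x v : X x -> W v -> X (F x v) by exact: recursive_feasibility.
pose Z := minkowski_series (A + B *m K) D W.
have [e1 e10 Ze1] := minkowski_series_ball PhiD_controllable W_interior.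
have /nbhs_ballP[e2 /= e20 near0] := inactive_near0.
pose e := Num.min e1 e2; have e0 : 0 < e by rewrite lt_min e10 e20.
pose T x := Z x /\ Xf x.
have T_ball x : `|x| < e -> T x.
  rewrite lt_min => /andP[xe1 xe2]; split; first exact: Ze1.
  have xb : ball (0 : 'cV[R]_nx) e2 x by rewrite -ball_normE /= sub0r normrN.
  by have [Xx _ c0] := near0 x xb.
have F_linear x v : Xf x -> F x v = (A + B *m K) *m x + D *m v.
  by move=> [_ c0]; rewrite /F /closed_loop -/(c0star x) c0 addr0 mulmxDl mulmxA.
have T_inv x v : T x -> W v -> T (F x v).
  move=> [Zx Xfx] Wv; split; last exact: Xf_invariant.
  by rewrite F_linear//; exact: minkowski_series_step.
have [r [lambda [l0 entrance]]] := closed_loop_entrance w_random w_identical Q_posdef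
  Ru_posdef S_sym S_unit S_riccati K_def K_stabilizing N_gt0 N2_large X_bounded
  cstar_feasible cstar_minimal e0.
pose U : set 'cV[R]_nw := [set y | `|y| <= lambda].
have U_borel : borel R nw U.
  apply: borel_closed.
  apply: (@preimage_closed _ _ (fun y : 'cV[R]_nw => `|y|) [set z : R | z <= lambda]).
    by move=> y _; exact: norm_continuous.
  exact: closed_le.
have U_gt0 : (0 < P (w 0%N @^-1` U))%E by exact: w_small.
(* A run of small disturbances drives the state into a ball inside the invariant set
   [T]. *)
have absorbed omega b : (forall k, W (w k omega)) -> run w U r.+1 (b * r.+1)%N omega ->
    forall k, (b.+1 * r.+1 <= k)%N -> T (xk k omega).
  move=> Wo ro k bk; set j := (b * r.+1)%N.
  have Xj : X (xk j omega) by exact: (trajectory_invariant FX).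
  have [t tr xt] := entrance (xk j omega) (fun i => w (j + i)%N omega) Xj
    (fun i => Wo _) (fun t tr => ro t tr).
  have Tt : T (xk (j + t)%N omega) by rewrite /xk trajectoryD; exact: T_ball.
  have jk : (j + t <= k)%N.
    by rewrite (leq_trans _ bk)// mulSn addnC leq_add2r ltnW.
  rewrite -(subnKC jk) /xk trajectoryD.
  by apply: (trajectory_invariant T_inv Tt) => i; exact: Wo.
split.
  apply: (inner_prob_cvg1 (G := no_run w U r.+1) (r := r)).
  - by move=> i; exact: (no_run_measurable w_random w_independent w_identical).
  - exact: no_run_cvg0.
  move=> i k ik; apply: filterS w_support => omega Wo nr.
  have [b bi rb] : exists2 b, (b < i)%N & run w U r.+1 (b * r.+1)%N omega.
    apply: contrapT => none; apply: nr => b /= bi rb.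
    by apply: none; exists b.
  have [] // := absorbed omega b Wo rb k.
  by rewrite (leq_trans _ ik)// leq_mul2r.
exists (steady_state_cost P D w S); split.
  (* The linear trajectory is the prediction without gains and corrections. *)
  pose L0 (j : nat) : 'M[R]_(nu, nw) := 0.
  pose c0 (i : 'I_N) : 'cV[R]_nu := 0.
  have fb0 i omega : feedback_error L0 c0 (fun j => w j omega) i = 0.
    rewrite /feedback_error free_input_zero add0r big1// => j _.
    by rewrite /lag_gain /L0; case: ifP => _; rewrite mul0mx.
  have xiE k omega : pred_state A B D K L0 x0 c0 (fun j => w j omega) k = xik k omega.
    elim: k => // k IH; rewrite pred_stateS// IH fb0 mulmx0 addr0 //.
  have stageE k : (fun omega => qform (Q + K^T *m Ru *m K)%R (xik k omega)) =
      stage_cost A B D K L0 Q Ru w x0 c0 k.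
    apply/funext => omega; rewrite /stage_cost pred_inputE// xiE fb0 addr0.
    by rewrite qform_mxD -qform_mulmx.
  under eq_fun do rewrite stageE (expectation_stage _ _ _ W_bounded w_random w_support)//.
  have lim := mean_stage_cvg (D := D) (L := L0) W_bounded w_random w_independent
    w_identical w_mean0 w_support Q_posdef Ru_posdef S_sym S_unit S_riccati K_def
    K_stabilizing N_gt0 x0 c0.
  rewrite big1 in lim; last first.
    move=> j _; rewrite (eq_mean P (Y := fun=> 0)) ?mean_cst// => omega.
    by rewrite /lag_gain /L0; case: ifP => _; rewrite mul0mx qform0.
  rewrite addr0 in lim.
  apply: cvg_EFin; first exact: nearW.
  rewrite /steady_state_cost.
  rewrite (eq_mean P (Y := fun omega => qform S (D *m w 0%N omega))) //.
  by move=> omega; rewrite qform_mulmx.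
have [Cx Cx0 xC] := linear_trajectory_bounded D W_bounded Q_posdef Ru_posdef S_sym S_unit
  S_riccati K_def K_stabilizing x0.
have := linear_average_cost D W_bounded w_random w_independent w_identical w_mean0 w_support
  Q_posdef Ru_posdef S_sym S_unit S_riccati K_def K_stabilizing x0.
have := ae_run w_random w_independent w_identical r.+1 U_borel U_gt0.
move: w_support; apply: filterS3 => omega Wo [b rb] avg.
pose cost x := qform Q x + qform Ru (K *m x).
have [CM CM0 MC] := qform_bound (Q + K^T *m Ru *m K).
have costM x : cost x = qform (Q + K^T *m Ru *m K) x by rewrite qform_mxD -qform_mulmx.
have tail := absorbed omega b Wo rb.
apply: (average_transfer (b := fun k => cost (xik k omega)) (M := CM * Cx ^+ 2) _ avg) => [k|].
  rewrite costM (le_trans (MC _))// ler_wpM2l// lerXn2r ?nnegrE//.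
  exact: xC.
pose delta k := xk k omega - xik k omega.
have delta0 : delta @ \oo --> (0 : 'cV[R]_nx).
  apply: (stable_cvg0 (N := (b.+1 * r.+1)%N) K_stabilizing) => k bk.
  have [_ Xfk] := tail k bk.
  rewrite /delta mulmxBr.
  have -> : xk k.+1 omega = (A + B *m K) *m xk k omega + D *m w k omega by exact: F_linear.
  have -> : xik k.+1 omega = (A + B *m K) *m xik k omega + D *m w k omega by [].
  by rewrite opprD addrACA subrr addr0.
have [C1 C10 H1] := bform_bound (Q + K^T *m Ru *m K).
have sM : (Q + K^T *m Ru *m K)^T = Q + K^T *m Ru *m K.
  have [sQ _] := Q_posdef; have [sR _] := Ru_posdef.
  by rewrite linearD/= !trmx_mul trmxK sQ sR mulmxA.
have lim : (fun k => 2 * bform (Q + K^T *m Ru *m K) (xik k omega) (delta k)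
    + qform (Q + K^T *m Ru *m K) (delta k)) @ \oo --> (0 : R).
  rewrite -[X in _ --> X]addr0; apply: cvgD; last exact: cvg_qform0.
  apply/cvgr0Pnorm_lt => h h0.
  have c0 : 0 < 2 * (C1 * Cx) + 1 by rewrite ltr_wpDl// !mulr_ge0.
  have hc : 0 < h / (2 * (C1 * Cx) + 1) by rewrite divr_gt0.
  apply: filterS (cvg0_norm_bound delta0 hc) => k dk.
  rewrite normrM (ger0_norm (x := 2))//.
  apply: (@le_lt_trans _ _ ((2 * (C1 * Cx) + 1) * `|delta k|)); last first.
    by rewrite mulrC -ltr_pdivlMr.
  rewrite [leRHS]mulrDl mul1r ler_wpDr// -!mulrA ler_pM2l// (le_trans (H1 _ _))//.
  rewrite ler_wpM2l// ler_wpM2r//; exact: xC.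
apply: cvg_trans lim; apply: near_eq_cvg; exists (b.+1 * r.+1)%N => // k /= bk.
have [_ [_ c0]] := tail k bk.
rewrite /uk /law c0 addr0 -!/(cost _) !costM.
have -> : xk k omega = xik k omega + delta k by rewrite /delta addrC subrK.
by rewrite qformD//; ring.
Qed.
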